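(* Let $\Lambda$ be a basic finite-dimensional $\tau$-tilting finite algebra over a field $K$ that is hereditary, and let $\mathcal{T}\in\mathrm{tors}\,\Lambda$. Then $\mathcal{T}$ is in the image of $\mathrm{pop}^{\downarrow}_{\mathrm{tors}\,\Lambda}$ if and only if both (1) $\mathrm{Ext}^1_\Lambda(X,X')=0$ for all $X,X'\in\mathcal{D}(\mathcal{T})$, and (2) there is no nonzero projective module in $\mathcal{T}$. Dually, $\mathcal{T}$ is in the image of $\mathrm{pop}^{\uparrow}_{\mathrm{tors}\,\Lambda}$ if and only if both (1* ) $\mathrm{Ext}^1_\Lambda(Y,Y')=0$ for all $Y,Y'\in\mathcal{U}(\mathcal{T})$, and (2* ) there is no nonzero injective module in $\mathcal{T}^\perp$.
   Context: $\mathrm{mod}\,\Lambda$: finitely generated right $\Lambda$-modules; hereditary means $\mathrm{Ext}^m_\Lambda=0$ for $m>1$. $\mathrm{tors}\,\Lambda$: finite lattice of torsion classes (subcategories closed under extensions and quotients) under inclusion. $\mathrm{pop}^{\downarrow}(x)=x\wedge\bigwedge\{y:y\lessdot x\}$, $\mathrm{pop}^{\uparrow}(x)=x\vee\bigvee\{y:x\lessdot y\}$. A brick is a module with division-ring endomorphism ring. For a cover $\mathcal{T}_1\lessdot\mathcal{T}_2$, $\mathcal{T}_2\cap\mathcal{T}_1^\perp$ contains a unique brick up to isomorphism (its brick label), where $\mathcal{C}^\perp=\{M:\mathrm{Hom}(\mathcal{C},M)=0\}$. $\mathcal{D}(\mathcal{T})$ (resp. $\mathcal{U}(\mathcal{T})$):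 brick labels of covers $\mathcal{T}_1\lessdot\mathcal{T}$ (resp. $\mathcal{T}\lessdot\mathcal{T}_2$). *)

(* Defs.v *)
(* Finite-dimensional algebras over a field K are modelled as
   MathComp [falgType K]; finitely generated right modules are modelled
   concretely as representations: a module of dimension n is a unital
   algebra morphism A -> 'M[K]_n acting on row vectors on the right. *)
From HB Require Import structures.
From mathcomp Require Import all_boot all_order all_algebra all_field.
Set Implicit Arguments. Unset Strict Implicit. Unset Printing Implicit Defensive.
Import GRing.Theory.
Local Open Scope ring_scope.

Section ModuleCategory.
Variables (K : fieldType) (A : falgType K).

(* A finite-dimensional right A-module: v . a := v *m mact a. *)
Record rmodule := RModule {
  mdim : nat;
  mact : A -> 'M[K]_mdim;
  mact_linear : forall (k : K) (a b : A), mact (k *: a + b) = k *: mact a + mact b;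
  mact_mul : forall a b : A, mact (a * b) = mact a *m mact b;
  mact_one : mact 1 = 1%:M
}.

(* f : 'M_(dim M, dim N) represents a K-linear map M -> N (row vectors). *)
Definition is_hom (M N : rmodule) (f : 'M[K]_(mdim M, mdim N)) : Prop :=
  forall a : A, mact M a *m f = f *m mact N a.

Definition ses (X' E X : rmodule) (f : 'M[K]_(mdim X', mdim E))
  (g : 'M[K]_(mdim E, mdim X)) : Prop :=
  [/\ is_hom f, is_hom g, row_free f && row_full g,
      f *m g = 0 & (mdim X' + mdim X)%N = mdim E].

(* Ext^1(X, X') = 0 (Yoneda): every extension 0 -> X' -> E -> X -> 0 splits. *)
Definition Ext1_vanishes (X X' : rmodule) : Prop :=
  forall (E : rmodule) (f : 'M[K]_(mdim X', mdim E)) (g : 'M[K]_(mdim E, mdim X)),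
    ses f g -> exists s : 'M[K]_(mdim X, mdim E), is_hom s /\ s *m g = 1%:M.

Definition subcat := rmodule -> Prop.

Definition torsion_class (T : subcat) : Prop :=
  [/\ (forall M, mdim M = 0%N -> T M),
      (forall M N (g : 'M[K]_(mdim M, mdim N)), T M -> is_hom g -> row_full g -> T N) &
      (forall X' E X (f : 'M[K]_(mdim X', mdim E)) (g : 'M[K]_(mdim E, mdim X)),
          ses f g -> T X' -> T X -> T E)].

Definition subc (T1 T2 : subcat) : Prop := forall M, T1 M -> T2 M.
Definition eqc (T1 T2 : subcat) : Prop := subc T1 T2 /\ subc T2 T1.

Definition covers (T1 T2 : subcat) : Prop :=
  [/\ torsion_class T1, torsion_class T2, subc T1 T2, ~ subc T2 T1 &
      forall T, torsion_class T -> subc T1 T -> subc T T2 -> eqc T T1 \/ eqc T T2].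

Definition perp (C : subcat) : subcat := fun M =>
  forall N (f : 'M[K]_(mdim N, mdim M)), C N -> is_hom f -> f = 0.

Definition brick (X : rmodule) : Prop :=
  (0 < mdim X)%N /\
  forall f : 'M[K]_(mdim X), is_hom (M:=X) (N:=X) f -> f != 0 -> f \in unitmx.

Definition brick_label (T1 T2 : subcat) (X : rmodule) : Prop :=
  [/\ brick X, T2 X & perp T1 X].

Definition Dlabels (T : subcat) : subcat := fun X =>
  exists T1, covers T1 T /\ brick_label T1 T X.
Definition Ulabels (T : subcat) : subcat := fun Y =>
  exists T2, covers T T2 /\ brick_label T T2 Y.

(* pop-down: meet (= intersection) of T and all its lower covers *)
Definition pop_down (T : subcat) : subcat := fun M =>
  T M /\ forall T1, covers T1 T -> T1 M.
(* pop-up: join in tors A of T and all its upper covers, i.e. the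
   intersection of all torsion classes that are upper bounds *)
Definition pop_up (T : subcat) : subcat := fun M =>
  forall T', torsion_class T' -> subc T T' ->
    (forall T2, covers T T2 -> subc T2 T') -> T' M.

Definition in_image_pop_down (T : subcat) : Prop :=
  exists T', torsion_class T' /\ eqc (pop_down T') T.
Definition in_image_pop_up (T : subcat) : Prop :=
  exists T', torsion_class T' /\ eqc (pop_up T') T.

Definition projective_mod (P : rmodule) : Prop :=
  forall E X (g : 'M[K]_(mdim E, mdim X)) (h : 'M[K]_(mdim P, mdim X)),
    is_hom g -> row_full g -> is_hom h ->
    exists l : 'M[K]_(mdim P, mdim E), is_hom l /\ l *m g = h.

Definition injective_mod (I : rmodule) : Prop :=
  forall X E (f : 'M[K]_(mdim X, mdim E)) (h : 'M[K]_(mdim X, mdim I)),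
    is_hom f -> row_free f -> is_hom h ->
    exists l : 'M[K]_(mdim E, mdim I), is_hom l /\ f *m l = h.

(* hereditary: submodules of projective modules are projective
   (equivalently gl.dim <= 1, i.e. Ext^m = 0 for m > 1) *)
Definition hereditary : Prop :=
  forall M P (f : 'M[K]_(mdim M, mdim P)),
    projective_mod P -> is_hom f -> row_free f -> projective_mod M.

(* basic: for orthogonal primitive idempotents e, f, eA and fA are not
   isomorphic (Hom_A(eA, fA) = fAe). *)
Definition idempotent (e : A) : Prop := e * e = e.
Definition primitive_idem (e : A) : Prop :=
  [/\ idempotent e, e != 0 &
      forall e1 e2, idempotent e1 -> idempotent e2 -> e1 * e2 = 0 -> e2 * e1 = 0 ->
        e = e1 + e2 -> e1 = 0 \/ e2 = 0].
Definition proj_iso (e f : A) : Prop :=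
  exists x y : A, [/\ x = f * x * e, y = e * y * f, y * x = e & x * y = f].
Definition basic_alg : Prop :=
  forall e f, primitive_idem e -> primitive_idem f -> e * f = 0 -> f * e = 0 ->
    ~ proj_iso e f.

(* tau-tilting finite, via Demonet–Iyama–Jasso: tors A is finite *)
Definition tors_finite : Prop :=
  exists (k : nat) (Ts : nat -> subcat),
    forall T, torsion_class T -> exists2 i, (i < k)%N & eqc T (Ts i).

End ModuleCategory.

(* Main.v *)
(* All hypotheses and both halves of the theorem are self-dual up to exchanging
   T with its perpendicular F, so the argument runs in an abstract category of
   linear maps whose opposite is obtained by transposing matrices, and the
   pop-up half is the pop-down half in the opposite category. Heredity enters
   only as "any two extensions can be spliced", which is self-dual and makes
   Ext(X,-) right exact.

   Let T be a torsion class with perpendicular F. A lower label X of T is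
   characterised by: a map from T to X is zero or onto with kernel in T; hence
   a nonsplit extension of X by an object of F lies in F. Upper labels are dual.

   If T = pop-down S, put W := S meet F. A projective in T has no map to the
   lower labels of S, which generate S, so it vanishes. W is closed under
   cokernels of monomorphisms, so Ext(X,W) = 0 for every lower label X of T;
   some object of W maps onto each lower label X' of T, whence Ext(X,X') = 0 by
   right exactness.

   Conversely put S := pop-up T and W := S meet F, which is filtered by the
   upper labels of T. A lower cover of S not containing T has a label B that is
   a quotient of a lower label X of T, while W has no maps to B; so it is enough
   to find an epimorphism from W to X. Since X is not projective, Ext(X,-) = 0
   defines a proper torsion class; it has an upper label Z, and the middle term
   E of a nonsplit extension of X by Z is in F and satisfies Ext(X',E) = 0 for
   all lower labels X' of T, which forces E to be in W. *)
Require Import Defs.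
From Stdlib Require Import Classical.
From mathcomp Require Import all_boot all_order all_algebra all_field.
Set Implicit Arguments. Unset Strict Implicit. Unset Printing Implicit Defensive.
Import GRing.Theory.
Local Open Scope ring_scope.

(** * Injective and surjective matrices *)

Section MatrixFacts.
Variable K : fieldType.

Lemma row_full_comp m n p (f : 'M[K]_(m, n)) (g : 'M[K]_(n, p)) :
  row_full f -> row_full g -> row_full (f *m g).
Proof.
move=> /row_fullP [s sf] /row_fullP [t tg]; apply/row_fullP; exists (t *m s).
by rewrite -mulmxA (mulmxA s) sf mul1mx.
Qed.

Lemma row_free_comp m n p (f : 'M[K]_(m, n)) (g : 'M[K]_(n, p)) :
  row_free f -> row_free g -> row_free (f *m g).
Proof.
move=> /row_freeP [s fs] /row_freeP [t gt]; apply/row_freeP; exists (t *m s).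
by rewrite mulmxA -(mulmxA f) gt mulmx1.
Qed.

Lemma row_full_compr m n p (f : 'M[K]_(m, n)) (g : 'M[K]_(n, p)) :
  row_full (f *m g) -> row_full g.
Proof.
by move=> /row_fullP [s sfg]; apply/row_fullP; exists (s *m f); rewrite -mulmxA.
Qed.

Lemma row_free_compl m n p (f : 'M[K]_(m, n)) (g : 'M[K]_(n, p)) :
  row_free (f *m g) -> row_free f.
Proof.
by move=> /row_freeP [s fgs]; apply/row_freeP; exists (g *m s); rewrite mulmxA.
Qed.

Lemma row_full_id n : row_full (1%:M : 'M[K]_n).
Proof. by apply/row_fullP; exists 1%:M; rewrite mulmx1. Qed.

Lemma row_full_tr m n (f : 'M[K]_(m, n)) : row_full f^T = row_free f.
Proof. by rewrite /row_full /row_free mxrank_tr. Qed.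

Lemma row_free_tr m n (f : 'M[K]_(m, n)) : row_free f^T = row_full f.
Proof. by rewrite /row_full /row_free mxrank_tr. Qed.

Lemma row_full_dim0 m n (f : 'M[K]_(m, n)) : row_full f -> f = 0 -> n = 0%N.
Proof. by move=> /eqP r f0; rewrite -r f0 mxrank0. Qed.

Lemma row_free_dim0 m n (f : 'M[K]_(m, n)) : row_free f -> f = 0 -> m = 0%N.
Proof. by move=> /eqP r f0; rewrite -r f0 mxrank0. Qed.

Lemma id_dim0 n : (1%:M : 'M[K]_n) = 0 -> n = 0%N.
Proof. exact: row_full_dim0 (row_full_id n). Qed.

Lemma mx_dim0l m n (f : 'M[K]_(m, n)) : m = 0%N -> f = 0.
Proof. by move=> m0; apply/matrixP => -[i lt_i]; exfalso; rewrite m0 in lt_i. Qed.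

Lemma mx_dim0r m n (f : 'M[K]_(m, n)) : n = 0%N -> f = 0.
Proof. by move=> n0; apply/matrixP => i [j lt_j]; exfalso; rewrite n0 in lt_j. Qed.

End MatrixFacts.

(** * Self-dual categories of linear maps *)

(** This axiomatises an abelian category with a faithful exact functor to finite-dimensional spaces.
    Kernels and cokernels are pinned down by ranks; their universal properties follow from the two
    factorisation axioms. Every axiom is either self-dual or paired with its transpose, which is
    what makes [op] definable. *)
Record lincat (K : fieldType) := LinCat {
  ob :> Type;
  odim : ob -> nat;
  ohom : forall M N : ob, 'M[K]_(odim M, odim N) -> Prop;
  hom_id : forall M : ob, ohom (1%:M : 'M_(odim M, odim M));
  hom_zero : forall M N : ob, ohom (0 : 'M_(odim M, odim N));
  hom_comp : forall (L M N : ob) (f : 'M_(odim L, odim M)) (g : 'M_(odim M, odim N)),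
    ohom f -> ohom g -> ohom (f *m g);
  hom_sub : forall (M N : ob) (f g : 'M_(odim M, odim N)),
    ohom f -> ohom g -> ohom (f - g);
  hom_mono_factor :
    forall (L M N : ob) (f : 'M_(odim L, odim M)) (g : 'M_(odim M, odim N)),
    ohom (f *m g) -> ohom g -> row_free g -> ohom f;
  hom_epi_factor :
    forall (L M N : ob) (f : 'M_(odim L, odim M)) (g : 'M_(odim M, odim N)),
    ohom (f *m g) -> ohom f -> row_full f -> ohom g;
  has_kernel : forall (M N : ob) (f : 'M_(odim M, odim N)), ohom f ->
    exists (L : ob) (k : 'M_(odim L, odim M)),
      [/\ ohom k, row_free k, k *m f = 0 & (odim L + \rank f)%N = odim M];
  has_cokernel : forall (M N : ob) (f : 'M_(odim M, odim N)), ohom f ->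
    exists (L : ob) (c : 'M_(odim N, odim L)),
      [/\ ohom c, row_full c, f *m c = 0 & (odim L + \rank f)%N = odim N];
  has_biproduct : forall M N : ob,
    exists (S : ob) (i1 : 'M_(odim M, odim S)) (i2 : 'M_(odim N, odim S))
      (p1 : 'M_(odim S, odim M)) (p2 : 'M_(odim S, odim N)),
      [/\ ohom i1, ohom i2, ohom p1 & ohom p2] /\
      [/\ i1 *m p1 = 1%:M, i2 *m p2 = 1%:M, i1 *m p2 = 0, i2 *m p1 = 0 &
          p1 *m i1 + p2 *m i2 = 1%:M /\ (odim M + odim N)%N = odim S]
}.

(** * The opposite category, by transposition *)

Section Opposite.
Variables (K : fieldType) (C : lincat K).

Definition op_hom (M N : C) (f : 'M[K]_(odim M, odim N)) : Prop := ohom f^T.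

Program Definition op : lincat K := @LinCat K C (@odim K C) op_hom _ _ _ _ _ _ _ _ _.
Next Obligation. by rewrite /op_hom trmx1; apply: hom_id. Qed.
Next Obligation. by rewrite /op_hom trmx0; apply: hom_zero. Qed.
Next Obligation. by rewrite /op_hom trmx_mul; apply: hom_comp. Qed.
Next Obligation. by rewrite /op_hom linearB; apply: hom_sub. Qed.
Next Obligation.
move: H; rewrite /op_hom trmx_mul => H.
by apply: hom_epi_factor H _ _ => //; rewrite row_full_tr.
Qed.
Next Obligation.
move: H; rewrite /op_hom trmx_mul => H.
by apply: hom_mono_factor H _ _ => //; rewrite row_free_tr.
Qed.
Next Obligation.
have [L [c [hc fc cf dL]]] := has_cokernel H; exists L, c^T.
rewrite /op_hom trmxK row_free_tr; split=> //.
  by apply: trmx_inj; rewrite trmx_mul trmxK cf trmx0.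
by rewrite mxrank_tr in dL.
Qed.
Next Obligation.
have [L [c [hc fc cf dL]]] := has_kernel H; exists L, c^T.
rewrite /op_hom trmxK row_full_tr; split=> //.
  by apply: trmx_inj; rewrite trmx_mul trmxK cf trmx0.
by rewrite mxrank_tr in dL.
Qed.
Next Obligation.
have [S [i1 [i2 [p1 [p2 [[h1 h2 h3 h4] [e1 e2 e3 e4 [e5 e6]]]]]]]] := has_biproduct M N.
exists S, p1^T, p2^T, i1^T, i2^T; rewrite /op_hom !trmxK; split=> //.
by rewrite -!trmx_mul -linearD /= e1 e2 e3 e4 e5 !trmx1 !trmx0.
Qed.

End Opposite.

(** * Short exact sequences and pullbacks *)

Section ShortExact.
Variables (K : fieldType) (C : lincat K).
Implicit Types L M N X Y E : C.

Lemma homN M N (f : 'M[K]_(odim M, odim N)) : ohom f -> ohom (- f).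
Proof. by move=> hf; rewrite -(sub0r f); apply: hom_sub => //; apply: hom_zero. Qed.

Lemma homD M N (f g : 'M[K]_(odim M, odim N)) : ohom f -> ohom g -> ohom (f + g).
Proof. by move=> hf hg; rewrite -(opprK g); apply: hom_sub => //; apply: homN. Qed.

Definition exact_seq X' E X (f : 'M[K]_(odim X', odim E)) (g : 'M[K]_(odim E, odim X)) :=
  [/\ ohom f, ohom g, row_free f && row_full g,
      f *m g = 0 & (odim X' + odim X)%N = odim E].

Lemma exact_ker_eqmx X' E X (f : 'M[K]_(odim X', odim E)) (g : 'M[K]_(odim E, odim X)) :
  exact_seq f g -> (f :=: kermx g)%MS.
Proof.
move=> [_ _ /andP [ff gg] fg dE]; apply/eqmxP.
have le : (f <= kermx g)%MS by apply/sub_kermxP.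
rewrite -(geq_leqif (mxrank_leqif_eq le)) mxrank_ker (eqP gg) (eqP ff).
by rewrite -dE addnK.
Qed.

Lemma exact_factor_ker X' E X (f : 'M[K]_(odim X', odim E)) (g : 'M[K]_(odim E, odim X))
    L (h : 'M[K]_(odim L, odim E)) :
  exact_seq f g -> ohom h -> h *m g = 0 ->
  exists2 h' : 'M[K]_(odim L, odim X'), ohom h' & h = h' *m f.
Proof.
move=> s hh hg0; have [hf _ /andP [ff _] _ _] := s.
have /submxP [h' e] : (h <= f)%MS by rewrite (exact_ker_eqmx s); apply/sub_kermxP.
by exists h' => //; apply: (@hom_mono_factor _ _ _ _ _ h' f); rewrite -?e.
Qed.

Lemma mono_exact X' E (f : 'M[K]_(odim X', odim E)) : ohom f -> row_free f ->
  exists X (g : 'M[K]_(odim E, odim X)), exact_seq f g.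
Proof.
move=> hf ff; have [X [g [hg gg fg dX]]] := has_cokernel hf.
by exists X, g; split=> //; rewrite ?ff // -dX addnC (eqP ff).
Qed.

Lemma epi_exact E X (g : 'M[K]_(odim E, odim X)) : ohom g -> row_full g ->
  exists X' (f : 'M[K]_(odim X', odim E)), exact_seq f g.
Proof.
move=> hg gg; have [X' [f [hf ff fg dX]]] := has_kernel hg.
by exists X', f; split=> //; rewrite ?ff // -dX (eqP gg).
Qed.

Lemma image_factor M N (f : 'M[K]_(odim M, odim N)) : ohom f ->
  exists I (e : 'M[K]_(odim M, odim I)) (m : 'M[K]_(odim I, odim N)),
    [/\ ohom e, row_full e, ohom m, row_free m & f = e *m m].
Proof.
move=> hf; have [Q [c [hc cc fc dQ]]] := has_cokernel hf.
have [I [m sm]] := epi_exact hc cc.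
have [e he fE] := exact_factor_ker sm hf fc.
case: sm => hm _ /andP [mm _] _ dI; exists I, e, m; split=> //.
rewrite /row_full eqn_leq rank_leq_col /=.
suff rI : \rank f = odim I by rewrite -[X in (X <= _)%N]rI fE mxrankM_maxl.
by apply/eqP; rewrite -(eqn_add2r (odim Q)) dI addnC dQ.
Qed.

(** The pullback is the kernel of the difference map from the biproduct of [E] and [Y] to [X]. *)
Lemma pullback X' E X (f : 'M[K]_(odim X', odim E)) (g : 'M[K]_(odim E, odim X))
    Y (h : 'M[K]_(odim Y, odim X)) :
  exact_seq f g -> ohom h ->
  exists P (f' : 'M[K]_(odim X', odim P)) (g' : 'M[K]_(odim P, odim Y))
    (h' : 'M[K]_(odim P, odim E)),
    [/\ exact_seq f' g', ohom h', f' *m h' = f & h' *m g = g' *m h] /\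
    [/\ row_full h -> row_full h', row_free h -> row_free h' &
        forall L (u : 'M[K]_(odim L, odim Y)) (v : 'M[K]_(odim L, odim E)),
          ohom u -> ohom v -> u *m h = v *m g ->
          exists w : 'M[K]_(odim L, odim P), [/\ ohom w, w *m g' = u & w *m h' = v]].
Proof.
move=> [hf hg /andP [ff gg] fg dE] hh.
have [S [i1 [i2 [p1 [p2 [[hi1 hi2 hp1 hp2] [e11 e22 e12 e21 [idS dS]]]]]]]] :=
  has_biproduct E Y.
pose d := p1 *m g - p2 *m h.
have hd : ohom d by apply: hom_sub; apply: hom_comp.
have dd : row_full d.
  apply: (@row_full_compr _ _ _ _ i1).
  by rewrite mulmxBr !mulmxA e11 e12 mul1mx mul0mx subr0.
have [P [k sk]] := epi_exact hd dd.
have [hk _ /andP [kk _] kd dP] := sk.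
have kd' : k *m p1 *m g = k *m p2 *m h.
  by apply/eqP; rewrite -subr_eq0 -!mulmxA -mulmxBr kd.
(* [lift] and [proj] are stated for arbitrary matrices because the right inverses witnessing
   surjectivity of the two projections are only linear and need not be morphisms. *)
have lift n (u : 'M[K]_(n, odim Y)) (v : 'M[K]_(n, odim E)) : u *m h = v *m g ->
    exists w : 'M[K]_(n, odim P), w *m k = v *m i1 + u *m i2.
  move=> uv; have /submxP [w ->] : ((v *m i1 + u *m i2)%R <= k)%MS; last by exists w.
  rewrite (exact_ker_eqmx sk); apply/sub_kermxP.
  rewrite mulmxBr !mulmxDl !mulmxA -!(mulmxA v) -!(mulmxA u) e11 e22 e12 e21.
  by rewrite !mul1mx !mul0mx !mulmx0 addr0 add0r uv subrr.
have proj n (w : 'M[K]_(n, odim P)) (u : 'M[K]_(n, odim Y)) (v : 'M[K]_(n, odim E)) :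
    w *m k = v *m i1 + u *m i2 -> w *m (k *m p2) = u /\ w *m (k *m p1) = v.
  move=> e; rewrite !mulmxA e !mulmxDl -!mulmxA e11 e22 e12 e21.
  by rewrite !mulmx0 !mulmx1 addr0 add0r.
have univ L (u : 'M[K]_(odim L, odim Y)) (v : 'M[K]_(odim L, odim E)) :
    ohom u -> ohom v -> u *m h = v *m g ->
    exists w : 'M[K]_(odim L, odim P),
      [/\ ohom w, w *m (k *m p2) = u & w *m (k *m p1) = v].
  move=> hu hv uv; have [w we] := lift _ u v uv; have [w1 w2] := proj _ _ _ _ we.
  exists w; split=> //; apply: (@hom_mono_factor _ _ _ _ _ w k) => //; rewrite we.
  by apply: homD; apply: hom_comp.
have [f' [hf' f'2 f'1]] : exists w : 'M[K]_(odim X', odim P),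
    [/\ ohom w, w *m (k *m p2) = 0 & w *m (k *m p1) = f].
  by apply: univ => //; [apply: hom_zero | rewrite mul0mx fg].
exists P, f', (k *m p2), (k *m p1); split; split=> //.
- split=> //.
  + exact: hom_comp.
  + apply/andP; split; first by apply: (@row_free_compl _ _ _ _ _ (k *m p1)); rewrite f'1.
    have /row_fullP [s sg] := gg.
    have [|w we] := lift _ 1%:M (h *m s); first by rewrite mul1mx -mulmxA sg mulmx1.
    by apply/row_fullP; exists w; have [] := proj _ _ _ _ we.
  + apply/eqP; rewrite -(eqn_add2r (odim X)) dP -dS -dE; apply/eqP.
    by rewrite -!addnA (addnC (odim Y)).
- exact: hom_comp.
- move=> /row_fullP [s sh].
  have [|w we] := lift _ (g *m s) 1%:M; first by rewrite mul1mx -mulmxA sh mulmx1.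
  by apply/row_fullP; exists w; have [] := proj _ _ _ _ we.
- move=> hfree; apply: inj_row_free => v v0.
  have v2 : v *m (k *m p2) = 0.
    by apply: (row_free_inj hfree); rewrite /= mul0mx -mulmxA -kd' mulmxA v0 mul0mx.
  apply: (row_free_inj kk); rewrite /= mul0mx.
  rewrite -[v *m k]mulmx1 -idS mulmxDr (mulmxA _ p1) (mulmxA _ p2).
  by rewrite -(mulmxA v k p1) -(mulmxA v k p2) v0 v2 !mul0mx addr0.
Qed.

End ShortExact.

(** * Opposite sequences and pushouts *)

Section ExactDuality.
Variables (K : fieldType) (C : lincat K).
Implicit Types L M N X Y E : C.

Lemma exact_op X' E X (f : 'M[K]_(odim X', odim E)) (g : 'M[K]_(odim E, odim X)) :
  exact_seq f g -> @exact_seq K (op C) X E X' g^T f^T.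
Proof.
move=> [hf hg fg0 fg dE]; split=> /=; rewrite /op_hom ?trmxK //.
- by rewrite row_free_tr row_full_tr andbC.
- by rewrite -trmx_mul fg trmx0.
- by rewrite addnC.
Qed.

Lemma exact_unop X' E X (f : 'M[K]_(odim X', odim E)) (g : 'M[K]_(odim E, odim X)) :
  @exact_seq K (op C) X' E X f g -> @exact_seq K C X E X' g^T f^T.
Proof.
move=> [hf hg fg0 fg dE]; split=> //.
- by rewrite row_free_tr row_full_tr andbC.
- by rewrite -trmx_mul fg trmx0.
- by rewrite addnC.
Qed.

Lemma exact_factor_coker X' E X (f : 'M[K]_(odim X', odim E)) (g : 'M[K]_(odim E, odim X))
    L (h : 'M[K]_(odim E, odim L)) :
  exact_seq f g -> ohom h -> f *m h = 0 ->
  exists2 h' : 'M[K]_(odim X, odim L), ohom h' & h = g *m h'.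
Proof.
move=> s hh fh; have hh' : @ohom K (op C) L E h^T by rewrite /= /op_hom trmxK.
have [|h' hh2 e] := exact_factor_ker (exact_op s) hh'.
  by rewrite -trmx_mul fh trmx0.
by exists h'^T => //; apply: trmx_inj; rewrite trmx_mul trmxK.
Qed.

Lemma pushout X' E X (f : 'M[K]_(odim X', odim E)) (g : 'M[K]_(odim E, odim X))
    Y (h : 'M[K]_(odim X', odim Y)) :
  exact_seq f g -> ohom h ->
  exists P (f' : 'M[K]_(odim Y, odim P)) (g' : 'M[K]_(odim P, odim X))
    (h' : 'M[K]_(odim E, odim P)),
    [/\ exact_seq f' g', ohom h', h' *m g' = g & f *m h' = h *m f'] /\
    [/\ row_free h -> row_free h', row_full h -> row_full h' &
        forall L (u : 'M[K]_(odim Y, odim L)) (v : 'M[K]_(odim E, odim L)),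
          ohom u -> ohom v -> h *m u = f *m v ->
          exists w : 'M[K]_(odim P, odim L), [/\ ohom w, f' *m w = u & h' *m w = v]].
Proof.
move=> s hh; have hh' : @ohom K (op C) Y X' h^T by rewrite /= /op_hom trmxK.
have [P [f' [g' [h' [[s' hh2 e1 e2] [r1 r2 univ]]]]]] := pullback (exact_op s) hh'.
exists P, g'^T, f'^T, h'^T; split; split.
- exact: exact_unop.
- by [].
- by apply: trmx_inj; rewrite trmx_mul !trmxK.
- by apply: trmx_inj; rewrite !trmx_mul !trmxK.
- by rewrite row_free_tr -row_full_tr.
- by rewrite row_full_tr -row_free_tr.
- move=> L u v hu hv huv.
  have [|||w [hw w1 w2]] := univ L u^T v^T.
  + by rewrite /= /op_hom trmxK.
  + by rewrite /= /op_hom trmxK.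
  + by rewrite -!trmx_mul huv.
  + exists w^T; split=> //.
      by rewrite -trmx_mul w1 trmxK.
    by rewrite -trmx_mul w2 trmxK.
Qed.

End ExactDuality.

(** * Vanishing of Ext *)

Section Ext.
Variables (K : fieldType) (C : lincat K).
Implicit Types L M N X Y E : C.

Definition ext_zero X X' : Prop :=
  forall E (f : 'M[K]_(odim X', odim E)) (g : 'M[K]_(odim E, odim X)),
    exact_seq f g -> exists s : 'M[K]_(odim X, odim E), ohom s /\ s *m g = 1%:M.

Lemma section_retraction X' E X (f : 'M[K]_(odim X', odim E)) (g : 'M[K]_(odim E, odim X)) s :
  exact_seq f g -> ohom s -> s *m g = 1%:M ->
  exists r : 'M[K]_(odim E, odim X'), ohom r /\ f *m r = 1%:M.
Proof.
move=> sq hs sg; have [hf hg /andP [ff _] fg _] := sq.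
have [||r hr e] := @exact_factor_ker _ _ _ _ _ _ _ _ (1%:M - g *m s) sq.
- by apply: hom_sub; [apply: hom_id | apply: hom_comp].
- by rewrite mulmxBl mul1mx -mulmxA sg mulmx1 subrr.
exists r; split=> //; apply: (row_free_inj ff) => /=.
by rewrite -mulmxA -e mulmxBr mulmx1 mulmxA fg mul0mx subr0 mul1mx.
Qed.

Lemma ext_zero_extend X' E X (f : 'M[K]_(odim X', odim E)) (g : 'M[K]_(odim E, odim X))
    Y (h : 'M[K]_(odim X', odim Y)) :
  exact_seq f g -> ohom h -> ext_zero X Y ->
  exists2 l : 'M[K]_(odim E, odim Y), ohom l & f *m l = h.
Proof.
move=> s hh ext; have [P [f' [g' [h' [[s' hh' e1 e2] _]]]]] := pushout s hh.
have [t [ht tg]] := ext _ _ _ s'; have [r [hr fr]] := section_retraction s' ht tg.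
by exists (h' *m r); [apply: hom_comp | rewrite mulmxA e2 -mulmxA fr mulmx1].
Qed.

Lemma ext_zero_lift X' E X (f : 'M[K]_(odim X', odim E)) (g : 'M[K]_(odim E, odim X))
    Y (h : 'M[K]_(odim Y, odim X)) :
  exact_seq f g -> ohom h -> ext_zero Y X' ->
  exists2 l : 'M[K]_(odim Y, odim E), ohom l & l *m g = h.
Proof.
move=> s hh ext; have [P [f' [g' [h' [[s' hh' e1 e2] _]]]]] := pullback s hh.
have [t [ht tg]] := ext _ _ _ s'.
by exists (t *m h'); [apply: hom_comp | rewrite -mulmxA e2 mulmxA tg mul1mx].
Qed.

Lemma retraction_section X' E X (f : 'M[K]_(odim X', odim E)) (g : 'M[K]_(odim E, odim X)) r :
  exact_seq f g -> ohom r -> f *m r = 1%:M ->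
  exists s : 'M[K]_(odim X, odim E), ohom s /\ s *m g = 1%:M.
Proof.
move=> sq hr fr; have [hf hg /andP [_ gg] fg _] := sq.
have [||s hs e] := @exact_factor_coker _ _ _ _ _ _ _ _ (1%:M - r *m f) sq.
- by apply: hom_sub; [apply: hom_id | apply: hom_comp].
- by rewrite mulmxBr mulmx1 mulmxA fr mul1mx subrr.
exists s; split=> //; apply: (row_full_inj gg) => /=.
by rewrite mulmxA -e mulmxBl mul1mx -mulmxA fg mulmx0 subr0 mulmx1.
Qed.

(** Push an extension of [X] by [B] out along [g]. The result splits because it is an extension by
    [D], and its section lifts back because the kernel of [h'] is [A]. *)
Lemma ext_zero_extension X A B D (f : 'M[K]_(odim A, odim B)) (g : 'M[K]_(odim B, odim D)) :
  exact_seq f g -> @ext_zero X A -> @ext_zero X D -> @ext_zero X B.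
Proof.
move=> s extA extD E a b sab; have [hf hg /andP [ff gg] fg dB] := s.
have [P [f' [g' [h' [[s' hh' e1 e2] [_ h'full _]]]]]] := pushout sab hg.
have [t [ht tg]] := extD _ _ _ s'.
have [ha hb /andP [fa fb] ab dE] := sab.
have [_ _ _ _ dP] := s'.
have s2 : exact_seq (f *m a) h'.
  split=> //; first exact: hom_comp.
  - by rewrite row_free_comp // h'full.
  - by rewrite -mulmxA e2 mulmxA fg mul0mx.
  - by rewrite -dE -dB -dP addnA.
have [l hl lt] := ext_zero_lift s2 ht extA.
by exists l; split=> //; rewrite -e1 mulmxA lt.
Qed.

Lemma ext_zero_isor X X' Y (h : 'M[K]_(odim X, odim Y)) :
  ohom h -> row_free h -> row_full h -> ext_zero X X' -> ext_zero Y X'.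
Proof.
move=> hh ff gg ext E f g sfg; have [l hl lg] := ext_zero_lift sfg hh ext.
have [s sh] := row_fullP gg; exists (s *m l); split; last by rewrite -mulmxA lg.
by apply: (@hom_epi_factor _ _ _ _ _ h) => //; rewrite mulmxA;
  rewrite (_ : h *m s = 1%:M) ?mul1mx //; apply: (row_free_inj ff);
  rewrite /= -mulmxA sh mulmx1 mul1mx.
Qed.

(* Splicing two extensions: the Yoneda product of any two classes vanishes.
   This is the self-dual form of gl.dim <= 1. *)
Definition splicing : Prop :=
  forall A E1 B E2 D (f1 : 'M[K]_(odim A, odim E1)) (g1 : 'M[K]_(odim E1, odim B))
    (f2 : 'M[K]_(odim B, odim E2)) (g2 : 'M[K]_(odim E2, odim D)),
    exact_seq f1 g1 -> exact_seq f2 g2 ->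
    exists (G : C) (i : 'M[K]_(odim E1, odim G)) (p : 'M[K]_(odim G, odim E2)),
      [/\ ohom i /\ ohom p, row_free i, row_full p, i *m p = g1 *m f2 &
          (odim A + odim E2)%N = odim G].

(** Right exactness of Ext. Splicing the kernel sequence of [q] with an extension of [X] by [Q]
    gives an extension [G] of [X] by [M] lying over it; a section into [G] composed with [p] is a
    section of the original extension. *)
Lemma ext_zero_epi X M Q (q : 'M[K]_(odim M, odim Q)) :
  splicing -> ohom q -> row_full q -> ext_zero X M -> ext_zero X Q.
Proof.
move=> HH hq qq ext E f g sfg; have [A [k sk]] := epi_exact hq qq.
have [G [i [p [[hi hp] ii pp ip dG]]]] := HH _ _ _ _ _ _ _ _ _ sk sfg.
have [hf hg /andP [ff gg] fg dE] := sfg; have [_ _ _ _ dM] := sk.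
have [|s [hs sE]] := ext _ i (p *m g).
  split=> //; first exact: hom_comp.
  - by rewrite ii row_full_comp.
  - by rewrite mulmxA ip -mulmxA fg mulmx0.
  - by rewrite -dG -dE -dM addnA.
by exists (s *m p); split; [apply: hom_comp | rewrite -mulmxA].
Qed.

Definition proj_ob (P : C) : Prop :=
  forall E X (g : 'M[K]_(odim E, odim X)) (h : 'M[K]_(odim P, odim X)),
    ohom g -> row_full g -> ohom h ->
    exists l : 'M[K]_(odim P, odim E), ohom l /\ l *m g = h.

Definition inj_ob (I : C) : Prop :=
  forall X E (f : 'M[K]_(odim X, odim E)) (h : 'M[K]_(odim X, odim I)),
    ohom f -> row_free f -> ohom h ->
    exists l : 'M[K]_(odim E, odim I), ohom l /\ f *m l = h.

Lemma ext_zero_proj X : (forall M, ext_zero X M) -> proj_ob X.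
Proof.
move=> ext E Y g h hg gg hh; have [A [k sk]] := epi_exact hg gg.
by have [l hl lg] := ext_zero_lift sk hh (ext A); exists l.
Qed.

Lemma proj_biproduct_epi (R : C) :
  proj_ob R ->
  (forall M (v : 'rV[K]_(odim M)), exists2 f : 'M[K]_(odim R, odim M), ohom f & (v <= f)%MS) ->
  forall M, exists P (g : 'M[K]_(odim P, odim M)), [/\ proj_ob P, ohom g & row_full g].
Proof.
move=> pR gen M.
(* Copies of [R] are added one at a time, each reaching a vector outside the current image. The
   minimum with [odim M] lets the induction idle once the map is onto. *)
suff grow n : exists P (g : 'M[K]_(odim P, odim M)),
    [/\ proj_ob P, ohom g & (minn n (odim M) <= \rank g)%N].
  have [P [g [pP hg rg]]] := grow (odim M); exists P, g; split=> //.
  by rewrite /row_full eqn_leq rank_leq_col -{1}(minnn (odim M)).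
elim: n => [|n [P [g [pP hg rg]]]].
  by exists R, 0; split=> //; [apply: hom_zero | rewrite min0n].
have [gg|ngg] := boolP (row_full g).
  by exists P, g; split=> //; rewrite (eqP gg) geq_minr.
have [v nv] : exists v : 'rV[K]_(odim M), ~~ (v <= g)%MS.
  apply: NNPP => nex; case/negP: ngg; rewrite -sub1mx; apply/row_subP => i.
  by apply/negP => /negP nv; apply: nex; exists (row i 1%:M).
have [f hf vf] := gen M v.
have [S [i1 [i2 [p1 [p2 [[hi1 hi2 hp1 hp2] [e11 e22 e12 e21 [idS dS]]]]]]]] :=
  has_biproduct P R.
exists S, (p1 *m g + p2 *m f); split.
- move=> E X q h hq qq hh.
  have [l1 [hl1 e1]] := pP _ _ q (i1 *m h) hq qq (hom_comp hi1 hh).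
  have [l2 [hl2 e2]] := pR _ _ q (i2 *m h) hq qq (hom_comp hi2 hh).
  exists (p1 *m l1 + p2 *m l2); split; first by apply: homD; apply: hom_comp.
  by rewrite mulmxDl -!mulmxA e1 e2 !mulmxA -mulmxDl idS mul1mx.
- by apply: homD; apply: hom_comp.
set t := (X in \rank X).
have tg : (g <= t)%MS.
  by apply/submxP; exists i1; rewrite mulmxDr !mulmxA e11 e12 mul1mx mul0mx addr0.
have tf : (f <= t)%MS.
  by apply/submxP; exists i2; rewrite mulmxDr !mulmxA e21 e22 mul1mx mul0mx add0r.
have lt_gt : (\rank g < \rank t)%N.
  rewrite ltnNge (geq_leqif (mxrank_leqif_sup tg)); apply/negP => tg'.
  by case/negP: nv; apply: submx_trans vf (submx_trans tf tg').
apply: leq_trans lt_gt; apply: leq_trans (_ : (minn n (odim M)).+1 <= _)%N; last by [].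
by rewrite -minnSS leq_min geq_minl leqW // geq_minr.
Qed.

End Ext.

(** Resolve [D] by [P0] with kernel [P1], which is projective by heredity. The induced map from [P1]
    to [B] then lifts along [g1] to [E1], and [G] is the pushout of the inclusion of [P1] in [P0]
    along this lift. *)
Lemma hereditary_splicing (K : fieldType) (C : lincat K) :
  (forall M : C, exists (P : C) (g : 'M[K]_(odim P, odim M)),
     [/\ proj_ob P, ohom g & row_full g]) ->
  (forall (M P : C) (f : 'M[K]_(odim M, odim P)),
     proj_ob P -> ohom f -> row_free f -> proj_ob M) ->
  splicing C.
Proof.
move=> enough hered A E1 B E2 D f1 g1 f2 g2 s1 s2.
have [P0 [pi [pP0 hpi fpi]]] := enough D.
have [P1 [ka ska]] := epi_exact hpi fpi.
have [hka _ /andP [fka _] _ _] := ska.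
have pP1 := hered _ _ _ pP0 hka fka.
have [hf1 hg1 /andP [_ gg1] fg1 d1] := s1.
have [hf2 hg2 /andP [_ gg2] fg2 d2] := s2.
have [la [hla laE]] := pP0 _ _ g2 pi hg2 gg2 hpi.
have [|mu hmu muE] := exact_factor_ker s2 (hom_comp hka hla).
  by rewrite -mulmxA laE; case: ska.
have [nu [hnu nuE]] := pP1 _ _ g1 mu hg1 gg1 hmu.
have [G [i [q [th [[sG hth e1 e2] [_ _ univ]]]]]] := pushout ska hnu.
have [||p [hp ip tp]] := univ E2 (g1 *m f2) la _ hla.
- exact: hom_comp.
- by rewrite mulmxA nuE muE.
have [hi _ /andP [ii _] _ dG] := sG.
exists G, i, p; split=> //; last by rewrite -dG -d1 -d2 addnA.
have [w wpi] := row_fullP fpi; have [s sg1] := row_fullP gg1.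
(* Surjectivity of [p] is checked on vector spaces: [la] reaches every vector of [E2] up to an error
   in the image of [f2], and this error comes from [E1] through [g1]. *)
have /submxP [u uE] : ((1%:M - g2 *m w *m la)%R <= f2)%MS.
  rewrite (exact_ker_eqmx s2); apply/sub_kermxP.
  by rewrite mulmxBl mul1mx -!mulmxA laE wpi mulmx1 subrr.
apply/row_fullP; exists (g2 *m w *m th + u *m s *m i).
rewrite mulmxDl -!mulmxA tp ip (mulmxA s) sg1 mul1mx -uE !mulmxA.
by rewrite addrC subrK.
Qed.

Lemma splicing_op (K : fieldType) (C : lincat K) : splicing C -> splicing (op C).
Proof.
move=> HH A E1 B E2 D f1 g1 f2 g2 s1 s2.
have [_ _ _ _ d1] := s1; have [_ _ _ _ d2] := s2.
have [G [i [p [[hi hp] ii pp ip dG]]]] :=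
  HH _ _ _ _ _ _ _ _ _ (exact_unop s2) (exact_unop s1).
exists G, p^T, i^T; split=> //.
- by rewrite /= /op_hom !trmxK.
- by rewrite row_free_tr.
- by rewrite row_full_tr.
- by apply: trmx_inj; rewrite !trmx_mul !trmxK.
- by rewrite /= -dG -d1 /= -d2 /= addnA addnC.
Qed.

(** * Torsion classes *)

Section Torsion.
Variables (K : fieldType) (C : lincat K).
Implicit Types (L M N X Y E : C) (T F : C -> Prop).

Definition tors (T : C -> Prop) : Prop :=
  [/\ (forall M, odim M = 0%N -> T M),
      (forall M N (g : 'M[K]_(odim M, odim N)), T M -> ohom g -> row_full g -> T N) &
      (forall X' E X (f : 'M[K]_(odim X', odim E)) (g : 'M[K]_(odim E, odim X)),
          exact_seq f g -> T X' -> T X -> T E)].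

Definition sub_cl T1 T2 : Prop := forall M, T1 M -> T2 M.
Definition eq_cl T1 T2 : Prop := sub_cl T1 T2 /\ sub_cl T2 T1.

Definition is_cover T1 T2 : Prop :=
  [/\ tors T1, tors T2, sub_cl T1 T2, ~ sub_cl T2 T1 &
      forall T, tors T -> sub_cl T1 T -> sub_cl T T2 -> eq_cl T T1 \/ eq_cl T T2].

Definition rperp T : C -> Prop := fun M =>
  forall N (f : 'M[K]_(odim N, odim M)), T N -> ohom f -> f = 0.

Definition lperp F : C -> Prop := fun M =>
  forall N (f : 'M[K]_(odim M, odim N)), F N -> ohom f -> f = 0.

Definition brick_ob X : Prop :=
  (0 < odim X)%N /\
  forall f : 'M[K]_(odim X), @ohom K C X X f -> f != 0 -> f \in unitmx.

Definition label T1 T2 X : Prop := [/\ brick_ob X, T2 X & rperp T1 X].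

Definition Dlab T : C -> Prop := fun X => exists T1, is_cover T1 T /\ label T1 T X.
Definition Ulab T : C -> Prop := fun Y => exists T2, is_cover T T2 /\ label T T2 Y.

Definition popd T : C -> Prop := fun M => T M /\ forall T1, is_cover T1 T -> T1 M.
Definition popu T : C -> Prop := fun M =>
  forall T', tors T' -> sub_cl T T' -> (forall T2, is_cover T T2 -> sub_cl T2 T') -> T' M.

Definition im_popd T : Prop := exists T', tors T' /\ eq_cl (popd T') T.
Definition im_popu T : Prop := exists T', tors T' /\ eq_cl (popu T') T.

Definition fin_tors : Prop :=
  exists (k : nat) (Ts : nat -> (C -> Prop)),
    forall T, tors T -> exists2 i, (i < k)%N & eq_cl T (Ts i).

(** For a class that need not be a torsion class; by [gen_min] this is the smallest torsion class
    containing it. *)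
Definition gen T : C -> Prop := lperp (rperp T).

Lemma tors_quot T M N (g : 'M[K]_(odim M, odim N)) :
  tors T -> T M -> ohom g -> row_full g -> T N.
Proof. by case=> _ q _; apply: q. Qed.

Lemma tors_ext T X' E X (f : 'M[K]_(odim X', odim E)) (g : 'M[K]_(odim E, odim X)) :
  tors T -> exact_seq f g -> T X' -> T X -> T E.
Proof. by case=> _ _ e; apply: e. Qed.

Lemma tors_eq_cl T1 T2 : eq_cl T1 T2 -> tors T1 -> tors T2.
Proof.
move=> [s12 s21] [z q e]; split.
- by move=> M /z /s12.
- by move=> M N g /s21 TM hg gg; apply: s12; apply: q TM hg gg.
- by move=> X' E X f g sq /s21 T1X' /s21 T1X; apply: s12; apply: e sq _ _.
Qed.

Lemma rperp_sub T M N (f : 'M[K]_(odim N, odim M)) :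
  ohom f -> row_free f -> rperp T M -> rperp T N.
Proof.
move=> hf ff TM L u TL hu; apply: (row_free_inj ff); rewrite /= mul0mx.
by apply: TM => //; apply: hom_comp.
Qed.

Lemma rperp_ext T X' E X (f : 'M[K]_(odim X', odim E)) (g : 'M[K]_(odim E, odim X)) :
  exact_seq f g -> rperp T X' -> rperp T X -> rperp T E.
Proof.
move=> s TX' TX L u TL hu; have [hf hg _ _ _] := s.
have [|u' hu' ->] := exact_factor_ker s hu.
  by apply: TX => //; apply: hom_comp.
by rewrite (TX' _ u') // mul0mx.
Qed.

Lemma rperp_anti T1 T2 : sub_cl T1 T2 -> sub_cl (rperp T2) (rperp T1).
Proof. by move=> s M TM N f /s; apply: TM. Qed.

Lemma lperp_anti T1 T2 : sub_cl T1 T2 -> sub_cl (lperp T2) (lperp T1).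
Proof. by move=> s M TM N f /s; apply: TM. Qed.

Lemma lperp_tors F : tors (lperp F).
Proof.
split.
- by move=> M M0 N f _ _; apply: mx_dim0l.
- move=> M N g FM hg gg L u FL hu; apply: (row_full_inj gg); rewrite /= mulmx0.
  by apply: FM => //; apply: hom_comp.
- move=> X' E X f g s FX' FX L u FL hu; have [hf hg _ _ _] := s.
  have [|u' hu' ->] := exact_factor_coker s hu.
    by apply: FX' => //; apply: hom_comp.
  by rewrite (FX _ u') // mulmx0.
Qed.

Lemma tors_cap T1 T2 : tors T1 -> tors T2 -> tors (fun M => T1 M /\ T2 M).
Proof.
move=> [z1 q1 e1] [z2 q2 e2]; split.
- by move=> M M0; split; [apply: z1 | apply: z2].
- by move=> M N g [? ?] hg gg; split; [apply: q1 hg gg | apply: q2 hg gg].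
- by move=> X' E X f g s [? ?] [? ?]; split; [apply: e1 s _ _ | apply: e2 s _ _].
Qed.

Lemma self_perp_dim0 T M : T M -> rperp T M -> odim M = 0%N.
Proof. by move=> TM FM; apply: (@id_dim0 K); apply: FM TM (hom_id M). Qed.

(** Induction on dimension: the image [I] of a nonzero map from [T] lies in [T], and the preimage in
    [M] of the torsion part of the cokernel of [I] is the torsion part of [M]. *)
Lemma torsion_part T M : tors T ->
  exists A B (f : 'M[K]_(odim A, odim M)) (g : 'M[K]_(odim M, odim B)),
    [/\ exact_seq f g, T A & rperp T B].
Proof.
move=> tT; have [n] := ubnP (odim M); elim: n M => // n IH M; rewrite ltnS => leMn.
have [FM|nFM] := classic (rperp T M).
  have [A [f s]] := epi_exact (hom_id M) (row_full_id K (odim M)).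
  exists A, M, f, 1%:M; split=> //; have [z _ _] := tT; apply: z.
  by have [_ _ _ _ d] := s; apply/eqP; rewrite -(eqn_add2r (odim M)) d.
have [N [h [TN hh h0]]] : exists N (h : 'M[K]_(odim N, odim M)), [/\ T N, ohom h & h <> 0].
  apply: NNPP => nex; apply: nFM => N h TN hh; apply: NNPP => h0.
  by apply: nex; exists N, h.
have [I [e [m [he ee hm mm hE]]]] := image_factor hh.
have TI : T I := tors_quot tT TN he ee.
have [Q [c s]] := mono_exact hm mm; have [_ hc /andP [_ cc] mc dM] := s.
have ltQ : (odim Q < n)%N.
  apply: leq_trans leMn; rewrite -dM -[X in (X < _)%N]add0n ltn_add2r lt0n.
  by apply/eqP => I0; apply: h0; rewrite hE (mx_dim0l m I0) mulmx0.
have [A [B [f [g [sfg TA FB]]]]] := IH Q ltQ.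
have [hf hg /andP [ff gg] fg dQ] := sfg.
have [P [f' [g' [h' [[s' hh' e1 e2] [_ h'free _]]]]]] := pullback s hf.
have [_ _ _ _ dP] := s'.
exists P, B, h', (c *m g); split=> //.
- split=> //; first exact: hom_comp.
  + by rewrite h'free // row_full_comp.
  + by rewrite mulmxA e2 -mulmxA fg mulmx0.
  + by rewrite -dP -dM -dQ addnA.
- exact: tors_ext tT s' TI TA.
Qed.

Lemma gen_min T S : tors T -> sub_cl S T -> sub_cl (gen S) T.
Proof.
move=> tT ST M gM; have [A [B [f [g [s TA FB]]]]] := torsion_part M tT.
have [hf hg /andP [ff gg] fg d] := s; have g0 : g = 0.
  by apply: gM => //; apply: rperp_anti FB.
have B0 := row_full_dim0 gg g0; apply: (tors_ext tT s TA).
by case: tT => z _ _; apply: z.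
Qed.

Lemma gen_sub T : sub_cl T (gen T).
Proof. by move=> M TM N f FN hf; apply: FN TM hf. Qed.

Lemma gen_tors T : tors (gen T).
Proof. exact: lperp_tors. Qed.

Lemma lperp_rperp T : tors T -> sub_cl (lperp (rperp T)) T.
Proof. by move=> tT; apply: gen_min. Qed.

Lemma popd_tors T : tors T -> tors (popd T).
Proof.
move=> tT; split.
- move=> M M0; split; first by case: tT => z _ _; apply: z.
  by move=> T1 [[z _ _] _ _ _ _]; apply: z.
- move=> M N g [TM cM] hg gg; split; first exact: tors_quot tT TM hg gg.
  by move=> T1 c; have [tT1 _ _ _ _] := c; apply: tors_quot tT1 (cM _ c) hg gg.
- move=> X' E X f g s [TX' cX'] [TX cX]; split; first exact: tors_ext tT s TX' TX.
  move=> T1 c; have [tT1 _ _ _ _] := c.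
  exact: tors_ext tT1 s (cX' _ c) (cX _ c).
Qed.

End Torsion.

(** Only a preorder is assumed, since torsion classes are compared up to mutual inclusion.
    Minimality is tested against the listed representatives alone. *)
Lemma finite_minimal (X : Type) (le : X -> X -> Prop) (P : X -> Prop) (Ts : nat -> X) k x :
  (forall x, le x x) -> (forall y x z, le x y -> le y z -> le x z) -> P x ->
  exists m, [/\ P m, le m x & forall i, (i < k)%N -> P (Ts i) -> le (Ts i) m -> le m (Ts i)].
Proof.
move=> lexx letr; elim: k x => [|k IH] x Px; first by exists x.
have [m [Pm mx min_m]] := IH x Px.
have [[PT [Tm nmT]]|nT] := classic (P (Ts k) /\ le (Ts k) m /\ ~ le m (Ts k)).
  have [m' [Pm' m'x min_m']] := IH _ PT; exists m'; split=> //.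
    by apply: letr m'x (letr _ _ _ Tm mx).
  by move=> i; rewrite ltnS leq_eqVlt => /orP [/eqP ->|/min_m'].
exists m; split=> // i; rewrite ltnS leq_eqVlt => /orP [/eqP -> PT Tm|/min_m //].
by apply: NNPP => nmT; apply: nT.
Qed.

(** * Existence of covers in a finite lattice *)

Section Covers.
Variables (K : fieldType) (C : lincat K).
Hypothesis fin : fin_tors C.
Implicit Types (T S : C -> Prop).

Lemma lower_cover_above S T : tors S -> tors T -> sub_cl S T -> ~ sub_cl T S ->
  exists2 T1, is_cover T1 T & sub_cl S T1.
Proof.
move=> tS tT ST nTS; have [k [Ts finT]] := fin.
pose P U := [/\ tors U, sub_cl S U, sub_cl U T & ~ sub_cl T U].
(* The order is reversed, so the minimal element found is a maximal torsion class properly contained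
   in [T]. *)
have [|||m [[tm Sm mT nTm] _ max_m]] :=
  @finite_minimal _ (fun U V => sub_cl V U) P Ts k S.
- by move=> U M.
- by move=> U V W VU UW M /UW /VU.
- by split=> // M.
exists m => //; split=> // U tU mU UT.
have [TU|nTU] := classic (sub_cl T U); first by right.
have [i lt_i [UTi TiU]] := finT U tU; left; split=> // M UM.
apply: (max_m i lt_i) => [||]; last exact: UTi.
- split; first exact: tors_eq_cl (conj UTi TiU) tU.
  + by move=> N /Sm /mU /UTi.
  + by move=> N /TiU /UT.
  + by move=> TTi; apply: nTU => N /TTi /TiU.
- by move=> N /mU /UTi.
Qed.

Lemma upper_cover_below S T : tors S -> tors T -> sub_cl S T -> ~ sub_cl T S ->
  exists2 T2, is_cover S T2 & sub_cl T2 T.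
Proof.
move=> tS tT ST nTS; have [k [Ts finT]] := fin.
pose P U := [/\ tors U, sub_cl S U, sub_cl U T & ~ sub_cl U S].
have [|||m [[tm Sm mT nmS] _ min_m]] :=
  @finite_minimal _ (@sub_cl K C) P Ts k T.
- by move=> U M.
- by move=> U V W VU UW M /VU /UW.
- by split=> // M.
exists m => //; split=> // U tU SU Um.
have [US|nUS] := classic (sub_cl U S); first by left.
have [i lt_i [UTi TiU]] := finT U tU; right; split=> // M mM.
apply: (TiU M); apply: (min_m i lt_i) mM.
- split; first exact: tors_eq_cl (conj UTi TiU) tU.
  + by move=> N /SU /UTi.
  + by move=> N /TiU /Um /mT.
  + by move=> TiS; apply: nUS => N /UTi /TiS.
- by move=> N /TiU /Um.
Qed.

End Covers.

(** * Brick labels *)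

Section Labels.
Variables (K : fieldType) (C : lincat K).
Implicit Types (L M N X Y E : C) (T F : C -> Prop).

Lemma exists_min_dim (P : C -> Prop) :
  (exists M, P M) -> exists2 M, P M & forall N, P N -> (odim M <= odim N)%N.
Proof.
move=> [M]; have [n] := ubnP (odim M); elim: n M => // n IH M; rewrite ltnS => leMn PM.
have [[N [PN ltNM]]|nN] := classic (exists N, P N /\ (odim N < odim M)%N).
  by apply: (IH N) => //; apply: leq_trans ltNM leMn.
exists M => // N PN; rewrite leqNgt; apply/negP => ltNM.
by apply: nN; exists N.
Qed.

Lemma not_sub_cl T1 T2 : ~ sub_cl T2 T1 -> exists M, T2 M /\ ~ T1 M.
Proof.
move=> n; apply: NNPP => nex; apply: n => M TM; apply: NNPP => nT.
by apply: nex; exists M.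
Qed.

(** Take [Y] of least dimension in [T2] but not in [T1]. Its torsion-free quotient, and the image of
    any nonzero endomorphism, are again in [T2] and not in [T1], so both have the full dimension of
    [Y]. *)
Lemma label_exists T1 T2 : is_cover T1 T2 -> exists Y, label T1 T2 Y.
Proof.
move=> [t1 t2 s12 /not_sub_cl ns _].
have [Y [T2Y nT1Y] minY] := exists_min_dim ns.
have FY : rperp T1 Y.
  have [A [B [f [g [s TA FB]]]]] := torsion_part Y t1.
  have [hf hg /andP [ff gg] fg d] := s.
  have leYB : (odim Y <= odim B)%N.
    apply: minY; split; first exact: tors_quot t2 T2Y hg gg.
    by move=> TB; apply: nT1Y; apply: tors_ext t1 s TA TB.
  apply: rperp_sub hg _ FB; rewrite /row_free eqn_leq rank_leq_row /=.
  by rewrite (eqP gg).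
exists Y; split=> //; split.
  rewrite lt0n; apply/eqP => Y0; apply: nT1Y.
  by case: t1 => z _ _; apply: z.
move=> f hf f0; have [I [e [m [he ee hm mm fE]]]] := image_factor hf.
have leYI : (odim Y <= odim I)%N.
  apply: minY; split; first exact: tors_quot t2 T2Y he ee.
  by move=> TI; move/eqP: f0; apply; rewrite fE (FY _ _ TI hm) mulmx0.
rewrite -row_free_unit /row_free eqn_leq rank_leq_row /= fE mxrankMfree //.
by rewrite (eqP ee).
Qed.

Section FixedCover.
Variables (T1 T2 : C -> Prop) (Y : C).
Hypotheses (cov : is_cover T1 T2) (lab : label T1 T2 Y).

Lemma label_dim : (0 < odim Y)%N. Proof. by case: lab => -[]. Qed.

Lemma label_notin : ~ T1 Y.
Proof.
move=> T1Y; have [_ _ FY] := lab; have := label_dim.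
by rewrite (self_perp_dim0 T1Y FY).
Qed.

Lemma cover_gen_label : sub_cl T2 (gen (fun M => T1 M \/ M = Y)).
Proof.
have [t1 t2 s12 ns dich] := cov; have [_ T2Y FY] := lab.
have [||[s _]|[_ s]] := dich (gen (fun M => T1 M \/ M = Y)) (gen_tors _).
- by move=> M TM; apply: gen_sub; left.
- by apply: gen_min => // M [/s12|->].
- by case: label_notin; apply: s; apply: gen_sub; right.
- by [].
Qed.

(** The objects of [T2] without nonzero maps to [Y] form a torsion class that contains [T1] and
    misses [Y], so it is [T1]. *)
Lemma cover_lperp_label M :
  T2 M -> (forall h : 'M[K]_(odim M, odim Y), ohom h -> h = 0) -> T1 M.
Proof.
have [t1 t2 s12 ns dich] := cov; have [_ T2Y FY] := lab.
pose T N := T2 N /\ lperp (fun L => L = Y) N.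
have tT : tors T := tors_cap t2 (lperp_tors _).
have [||[s _]|[_ s]] := dich T tT.
- by move=> N TN; split; [apply: s12 | move=> L f LY; subst L; apply: FY].
- by move=> N [].
- by move=> T2M hM; apply: s; split=> // N f NY; subst N; apply: hM.
- have [_ Yperp] := s _ T2Y; exfalso; have := label_dim.
  by rewrite (id_dim0 (Yperp Y 1%:M erefl (hom_id Y))).
Qed.

Lemma brick_inv (f : 'M[K]_(odim Y)) : @ohom K C Y Y f -> f <> 0 ->
  f \in unitmx /\ @ohom K C Y Y (invmx f).
Proof.
move=> hf /eqP f0; have [[_ br] _ _] := lab; have uf := br f hf f0; split=> //.
apply: (@hom_mono_factor _ _ _ _ _ _ f) => //; last by rewrite row_free_unit.
by rewrite mulVmx //; apply: hom_id.
Qed.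

(** The image of [f] is in [T2] but not in [T1], so it has a nonzero map to [Y]. The composite is a
    nonzero endomorphism of the brick [Y], hence invertible. *)
Lemma label_mono M (f : 'M[K]_(odim Y, odim M)) :
  ohom f -> rperp T1 M -> f <> 0 -> row_free f.
Proof.
move=> hf FM f0; have [_ t2 _ _ _] := cov; have [_ T2Y _] := lab.
have [I [e [m [he ee hm mm fE]]]] := image_factor hf.
have T2I : T2 I := tors_quot t2 T2Y he ee.
have FI : rperp T1 I := rperp_sub hm mm FM.
have [[h [hh h0]]|nh] := classic (exists h : 'M[K]_(odim I, odim Y), ohom h /\ h <> 0).
  have [|u _] := brick_inv (hom_comp he hh).
    by move=> eh0; apply: h0; apply: (row_full_inj ee); rewrite /= eh0 mulmx0.
  rewrite fE; apply: row_free_comp mm; apply: (@row_free_compl _ _ _ _ _ h).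
  by rewrite row_free_unit.
have T1I : T1 I.
  by apply: cover_lperp_label => // h hh; apply: NNPP => h0; apply: nh; exists h.
by case: f0; rewrite fE (FM _ m T1I hm) mulmx0.
Qed.

(** Pull back to the image [I] of a map from [T1] to [Q]. The preimage [P] is in [T2] and
    torsion-free for [T1]. A nonzero map from [P] to [Y] cannot kill [Y], so it splits the extension
    and embeds [I] in [P], forcing [I] to vanish; with no such map, [P] is in [T1] and vanishes
    too. *)
Lemma label_coker M Q (f : 'M[K]_(odim Y, odim M)) (g : 'M[K]_(odim M, odim Q)) :
  exact_seq f g -> rperp T1 M -> rperp T1 Q.
Proof.
move=> s FM N u TN hu; have [t1 t2 s12 _ _] := cov; have [_ T2Y FY] := lab.
have [I [e [m [he ee hm mm uE]]]] := image_factor hu.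
have TI : T1 I := tors_quot t1 TN he ee.
suff I0 : odim I = 0%N by rewrite uE (mx_dim0l m I0) mulmx0.
have [P [f' [g' [h' [[s' hh' e1 e2] [_ h'free _]]]]]] := pullback s hm.
have [hf' hg' /andP [ff' gg'] fg' dP] := s'.
have T2P : T2 P := tors_ext t2 s' T2Y (s12 _ TI).
have FP : rperp T1 P := rperp_sub hh' (h'free mm) FM.
have [[h [hh h0]]|nh] := classic (exists h : 'M[K]_(odim P, odim Y), ohom h /\ h <> 0).
  have fh0 : f' *m h <> 0.
    move=> fh0; have [h2 hh2 hE] := exact_factor_coker s' hh fh0.
    by apply: h0; rewrite hE (FY _ h2) ?mulmx0.
  have [uh hi] := brick_inv (hom_comp hf' hh) fh0.
  have [||t [ht tg]] := @retraction_section _ _ _ _ _ _ _ (h *m invmx (f' *m h)) s'.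
  - exact: hom_comp.
  - by rewrite mulmxA mulmxV.
  by apply: (@id_dim0 K); rewrite -tg (FP _ t) // mul0mx.
have T1P : T1 P.
  by apply: cover_lperp_label => // h hh; apply: NNPP => h0; apply: nh; exists h.
by move: (self_perp_dim0 T1P FP); rewrite -dP => /eqP; rewrite addn_eq0 => /andP [_ /eqP].
Qed.

End FixedCover.
End Labels.

(** * Duality between torsion and torsion-free classes *)

Section TorsionDuality.
Variables (K : fieldType) (C : lincat K).
Implicit Types (L M N X Y E : C) (T F G : C -> Prop).

Lemma rperp_op F M : @rperp K (op C) F M <-> @lperp K C F M.
Proof.
split=> FM N f FN hf.
  apply: trmx_inj; rewrite trmx0; apply: FM => //.
  by rewrite /= /op_hom trmxK.
by apply: trmx_inj; rewrite trmx0; apply: FM.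
Qed.

Lemma lperp_op F M : @lperp K (op C) F M <-> @rperp K C F M.
Proof.
split=> FM N f FN hf.
  apply: trmx_inj; rewrite trmx0; apply: FM => //.
  by rewrite /= /op_hom trmxK.
by apply: trmx_inj; rewrite trmx0; apply: FM.
Qed.

Lemma rperp_tors_op T : @tors K (op C) (@rperp K C T).
Proof.
apply: tors_eq_cl (@lperp_tors K (op C) T); split=> M.
  by move/lperp_op.
by move=> TM; apply/lperp_op.
Qed.

Lemma rperp_lperp F : @tors K (op C) F -> sub_cl (@rperp K C (lperp F)) F.
Proof.
move=> tF M FM; apply: (lperp_rperp tF); apply/lperp_op => N f FN.
by apply: FM; apply/rperp_op.
Qed.

Lemma sub_rperp_lperp F : sub_cl F (@rperp K C (lperp F)).
Proof. by move=> M FM N f TN hf; apply: TN FM hf. Qed.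

(** Torsion classes of [op C] are the torsion-free classes of [C], and the two perpendiculars are
    mutually inverse, inclusion-reversing bijections between these and the torsion classes. *)
Lemma cover_op T1 T2 : @is_cover K C T1 T2 -> @is_cover K (op C) (rperp T2) (rperp T1).
Proof.
move=> [t1 t2 s12 ns dich]; split; try exact: rperp_tors_op.
- exact: (rperp_anti s12).
- move=> s; apply: ns => M /gen_sub gM; apply: lperp_rperp t1 _ _.
  exact: (@lperp_anti K C _ _ s _ gM).
move=> G tG s2 s1; have [||[sa sb]|[sa sb]] := dich (@lperp K C G) (@lperp_tors K C G).
- by move=> M /(@gen_sub K C) gM; apply: (@lperp_anti K C _ _ s1 _ gM).
- by move=> M GM; apply: lperp_rperp t2 _ _; apply: (@lperp_anti K C _ _ s2 _ GM).
- by right; split=> // M TM; apply: (rperp_lperp tG); apply: (@rperp_anti K C _ _ sa _ TM).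
- by left; split=> // M /sub_rperp_lperp GM; apply: (@rperp_anti K C _ _ sb _ GM).
Qed.

Lemma cover_unop F1 F2 : @is_cover K (op C) F1 F2 -> @is_cover K C (lperp F2) (lperp F1).
Proof.
move=> [t1 t2 s12 ns dich]; split; try exact: lperp_tors.
- exact: (@lperp_anti K C _ _ s12).
- move=> s; apply: ns => M /sub_rperp_lperp gM; apply: (rperp_lperp t1).
  exact: (@rperp_anti K C _ _ s _ gM).
move=> T tT s2 s1; have [||[sa sb]|[sa sb]] := dich (rperp T) (rperp_tors_op T).
- by move=> M /sub_rperp_lperp gM; apply: (@rperp_anti K C _ _ s1 _ gM).
- by move=> M GM; apply: (rperp_lperp t2); apply: (@rperp_anti K C _ _ s2 _ GM).
- by right; split=> // M TM; apply: lperp_rperp tT _ _; apply: (@lperp_anti K C _ _ sa _ TM).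
- by left; split=> // M /(@gen_sub K C) TM; apply: (@lperp_anti K C _ _ sb _ TM).
Qed.

Lemma brick_op X : @brick_ob K C X -> @brick_ob K (op C) X.
Proof.
move=> [X0 br]; split=> // f hf f0; rewrite -unitmx_tr; apply: br => //.
by rewrite -(inj_eq trmx_inj) trmxK trmx0.
Qed.

Lemma brick_unop X : @brick_ob K (op C) X -> @brick_ob K C X.
Proof.
move=> [X0 br]; split=> // f hf f0; rewrite -unitmx_tr; apply: br => //.
  by rewrite /= /op_hom trmxK.
by rewrite -(inj_eq trmx_inj) trmxK trmx0.
Qed.

Lemma label_op T1 T2 Y : label T1 T2 Y -> @label K (op C) (rperp T2) (rperp T1) Y.
Proof.
move=> [br T2Y FY]; split=> //; first exact: brick_op.
by apply/rperp_op; apply: gen_sub.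
Qed.

Lemma label_epi T1 T2 Y M (f : 'M[K]_(odim M, odim Y)) :
  is_cover T1 T2 -> label T1 T2 Y -> ohom f -> T2 M -> f <> 0 -> row_full f.
Proof.
move=> cov lab hf T2M f0; rewrite -row_free_tr.
apply: (@label_mono K (op C) _ _ _ (cover_op cov) (label_op lab)).
- by rewrite /= /op_hom trmxK.
- by apply/rperp_op; apply: gen_sub.
- by move=> ft; apply: f0; apply: trmx_inj; rewrite trmx0.
Qed.

Lemma label_ker T1 T2 L M Y (f : 'M[K]_(odim L, odim M)) (g : 'M[K]_(odim M, odim Y)) :
  is_cover T1 T2 -> label T1 T2 Y -> exact_seq f g -> T2 M -> T2 L.
Proof.
move=> cov lab s T2M; have [_ t2 _ _ _] := cov; apply: lperp_rperp t2 _ _.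
apply/rperp_op; apply: (label_coker (cover_op cov) (label_op lab) (exact_op s)).
by apply/rperp_op; apply: gen_sub.
Qed.

Lemma fin_tors_op : fin_tors C -> fin_tors (op C).
Proof.
move=> [k [Ts fin]]; exists k, (fun i => @rperp K C (Ts i)) => F tF.
have [i lt_i [s1 s2]] := fin (@lperp K C F) (@lperp_tors K C F); exists i => //.
split=> M.
  by move/sub_rperp_lperp; apply: rperp_anti.
by move=> TM; apply: rperp_lperp tF _ _; apply: rperp_anti TM.
Qed.

End TorsionDuality.

(** * Lower and upper labels of a torsion class *)

Section SidedLabels.
Variables (K : fieldType) (C : lincat K) (T : C -> Prop).
Hypothesis tT : tors T.
Implicit Types (L M N Q X Y E : C).

Lemma Dlab_dim X : Dlab T X -> (0 < odim X)%N.
Proof. by move=> [T1 [_ [[]]]]. Qed.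

Lemma Ulab_dim Y : Ulab T Y -> (0 < odim Y)%N.
Proof. by move=> [T1 [_ [[]]]]. Qed.

Lemma Dlab_in X : Dlab T X -> T X.
Proof. by move=> [T1 [_ []]]. Qed.

Lemma Ulab_perp Y : Ulab T Y -> rperp T Y.
Proof. by move=> [T1 [_ []]]. Qed.

Lemma Dlab_epi X M (f : 'M[K]_(odim M, odim X)) :
  Dlab T X -> ohom f -> T M -> f <> 0 -> row_full f.
Proof. by move=> [T1 [cov lab]]; apply: label_epi cov lab. Qed.

Lemma Dlab_ker X L M (f : 'M[K]_(odim L, odim M)) (g : 'M[K]_(odim M, odim X)) :
  Dlab T X -> exact_seq f g -> T M -> T L.
Proof. by move=> [T1 [cov lab]]; apply: label_ker cov lab. Qed.

Lemma Ulab_mono Y M (f : 'M[K]_(odim Y, odim M)) :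
  Ulab T Y -> ohom f -> rperp T M -> f <> 0 -> row_free f.
Proof. by move=> [T1 [cov lab]]; apply: label_mono cov lab _ _. Qed.

Lemma Ulab_coker Y M Q (f : 'M[K]_(odim Y, odim M)) (g : 'M[K]_(odim M, odim Q)) :
  Ulab T Y -> exact_seq f g -> rperp T M -> rperp T Q.
Proof. by move=> [T1 [cov lab]]; apply: label_coker cov lab _ _ _ _. Qed.

Lemma Dlab_sub X N (i : 'M[K]_(odim N, odim X)) :
  Dlab T X -> ohom i -> row_free i -> ~ row_full i -> rperp T N.
Proof.
move=> DX hi ii nfull L u TL hu; apply: NNPP => u0; apply: nfull.
apply: (@row_full_compr _ _ _ _ u); apply: (Dlab_epi DX) => //; first exact: hom_comp.
by move=> ui0; apply: u0; apply: (row_free_inj ii); rewrite /= ui0 mul0mx.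
Qed.

Lemma Ulab_quot Y Q (q : 'M[K]_(odim Y, odim Q)) :
  Ulab T Y -> ohom q -> row_full q -> ~ row_free q -> T Q.
Proof.
move=> UY hq qq nfree; apply: (lperp_rperp tT) => R u FR hu.
apply: NNPP => u0; apply: nfree.
apply: (@row_free_compl _ _ _ _ _ u); apply: (Ulab_mono UY) => //; first exact: hom_comp.
by move=> qu0; apply: u0; apply: (row_full_inj qq); rewrite /= qu0 mulmx0.
Qed.

(** Let [I] be the image in [E] of an object of [T]. If [I] dies in [X], it lies in the torsion-free
    [U] and is zero. Otherwise [I] maps onto [X] with kernel in [T]; this kernel embeds in [U], so
    it is zero and [I] provides a section. *)
Lemma Dlab_extension X U E (f : 'M[K]_(odim U, odim E)) (g : 'M[K]_(odim E, odim X)) :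
  Dlab T X -> exact_seq f g -> rperp T U ->
  ~ (exists s : 'M[K]_(odim X, odim E), ohom s /\ s *m g = 1%:M) -> rperp T E.
Proof.
move=> DX s FU nsplit N u TN hu; have [hf hg /andP [ff gg] fg d] := s.
have [I [e [m [he ee hm mm uE]]]] := image_factor hu.
have TI : T I := tors_quot tT TN he ee.
have [mg0|mg0] := classic (m *m g = 0).
  have [m' hm' mE] := exact_factor_ker s hm mg0.
  by rewrite uE mE (FU _ m') // mul0mx mulmx0.
have mg : row_full (m *m g) := Dlab_epi DX (hom_comp hm hg) TI mg0.
have [L [k sk]] := epi_exact (hom_comp hm hg) mg.
have TL : T L := Dlab_ker DX sk TI.
have [hk _ /andP [kk _] kmg dI] := sk.
have [|k' hk' kE] := exact_factor_ker s (hom_comp hk hm).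
  by rewrite -mulmxA.
have L0 : odim L = 0%N.
  by apply: (row_free_dim0 (row_free_comp kk mm)); rewrite kE (FU _ k') // mul0mx.
have [t tmg] := row_fullP mg.
have mgt : m *m g *m t = 1%:M.
  have mgfree : row_free (m *m g) by rewrite /row_free (eqP mg) -dI L0.
  by apply: (row_free_inj mgfree); rewrite /= -mulmxA tmg mulmx1 mul1mx.
case: nsplit; exists (t *m m); split; last by rewrite -mulmxA.
apply: (hom_comp _ hm); apply: (@hom_epi_factor _ _ _ _ _ (m *m g)) => //.
  by rewrite mgt; apply: hom_id.
exact: hom_comp.
Qed.

Lemma Dlab_hom_iso X X' (h : 'M[K]_(odim X, odim X')) :
  Dlab T X -> Dlab T X' -> ohom h -> h <> 0 -> row_free h /\ row_full h.
Proof.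
move=> DX DX' hh h0; have hfull := Dlab_epi DX' hh (Dlab_in DX) h0; split=> //.
have [L [k sk]] := epi_exact hh hfull; have [hk _ /andP [kk _] kh dX] := sk.
have TL : T L := Dlab_ker DX' sk (Dlab_in DX).
have [kfull|nkfull] := classic (row_full k).
  by case: h0; apply: (row_full_inj kfull); rewrite /= kh mulmx0.
have FL := Dlab_sub DX hk kk nkfull.
by rewrite /row_free (eqP hfull) -dX (self_perp_dim0 TL FL).
Qed.

Lemma Ulab_hom_iso Y Y' (h : 'M[K]_(odim Y, odim Y')) :
  Ulab T Y -> Ulab T Y' -> ohom h -> h <> 0 -> row_free h /\ row_full h.
Proof.
move=> UY UY' hh h0; have hfree := Ulab_mono UY hh (Ulab_perp UY') h0; split=> //.
have [L [k sk]] := mono_exact hh hfree; have [_ hk /andP [_ kk] kh dX] := sk.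
have FL : rperp T L := Ulab_coker UY sk (Ulab_perp UY').
have [kfree|nkfree] := classic (row_free k).
  by case: h0; apply: (row_free_inj kfree); rewrite /= kh mul0mx.
have TL := Ulab_quot UY' hk kk nkfree.
by rewrite /row_full (eqP hfree) -dX (self_perp_dim0 TL FL) addn0.
Qed.

(** Otherwise some lower cover of [T] would contain every lower label, including its own. *)
Lemma Dlab_gen : fin_tors C -> sub_cl T (gen (Dlab T)).
Proof.
move=> fin; apply: NNPP => ns.
have [|T1 cov s] := lower_cover_above fin (gen_tors (Dlab T)) tT _ ns.
  by apply: gen_min => // X; apply: Dlab_in.
have [X lab] := label_exists cov; case: (label_notin lab); apply: s.
by apply: gen_sub; exists T1.
Qed.

End SidedLabels.

(** * Isomorphisms and extensions by upper labels *)

Section IsoFacts.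
Variables (K : fieldType) (C : lincat K).
Implicit Types (L M N X Y E : C) (T F : C -> Prop).

Lemma iso_inv M N (f : 'M[K]_(odim M, odim N)) : ohom f -> row_free f -> row_full f ->
  exists g : 'M[K]_(odim N, odim M), [/\ ohom g, f *m g = 1%:M & g *m f = 1%:M].
Proof.
move=> hf ff gg; have [g gf] := row_fullP gg; exists g.
have fg : f *m g = 1%:M.
  by apply: (row_free_inj ff); rewrite /= -mulmxA gf mulmx1 mul1mx.
by split=> //; apply: hom_mono_factor hf ff; rewrite gf; apply: hom_id.
Qed.

Lemma coker_zero_full M N (f : 'M[K]_(odim M, odim N)) : ohom f ->
  (forall L (c : 'M[K]_(odim N, odim L)), ohom c -> f *m c = 0 -> c = 0) -> row_full f.
Proof.
move=> hf cz; have [L [c [hc cc fc d]]] := has_cokernel hf.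
have L0 : odim L = 0%N by apply: row_full_dim0 cc (cz _ _ hc fc).
by rewrite /row_full -[X in _ == X]d L0.
Qed.

Lemma row_free_eq_dim M N (f : 'M[K]_(odim M, odim N)) :
  row_full f -> odim M = odim N -> row_free f.
Proof. by move=> /eqP r d; rewrite /row_free r d. Qed.

Lemma exact_left0_free X' E X (f : 'M[K]_(odim X', odim E)) (g : 'M[K]_(odim E, odim X)) :
  exact_seq f g -> odim X' = 0%N -> row_free g.
Proof.
by move=> [_ _ /andP [_ gg] _ d] X0; apply: row_free_eq_dim => //; rewrite -d X0.
Qed.

Lemma exact_right0_full X' E X (f : 'M[K]_(odim X', odim E)) (g : 'M[K]_(odim E, odim X)) :
  exact_seq f g -> odim X = 0%N -> row_full f.
Proof.
by move=> [_ _ /andP [ff _] _ d] X0; rewrite /row_full (eqP ff) -d X0 addn0.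
Qed.

Lemma nonzero_hom (M N : C) :
  ~ (forall h : 'M[K]_(odim M, odim N), ohom h -> h = 0) ->
  exists2 h : 'M[K]_(odim M, odim N), ohom h & h <> 0.
Proof.
move=> n; apply: NNPP => nex; apply: n => h hh; apply: NNPP => h0.
by apply: nex; exists h.
Qed.

Lemma tors_zero T M : tors T -> odim M = 0%N -> T M.
Proof. by case=> z _ _; apply: z. Qed.

Lemma comp_mono_neq0 L M N (f : 'M[K]_(odim L, odim M)) (g : 'M[K]_(odim M, odim N)) :
  row_free g -> f <> 0 -> f *m g <> 0.
Proof. by move=> gg f0 fg; apply: f0; apply: (row_free_inj gg); rewrite /= fg mul0mx. Qed.

Lemma comp_epi_neq0 L M N (f : 'M[K]_(odim L, odim M)) (g : 'M[K]_(odim M, odim N)) :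
  row_full f -> g <> 0 -> f *m g <> 0.
Proof. by move=> ff g0 fg; apply: g0; apply: (row_full_inj ff); rewrite /= fg mulmx0. Qed.

Lemma Ulab_op T Y : Ulab T Y -> @Dlab K (op C) (rperp T) Y.
Proof.
by move=> [T2 [cov lab]]; exists (@rperp K C T2); split; [apply: cover_op | apply: label_op].
Qed.

Lemma Ulab_extension T Y E X (f : 'M[K]_(odim Y, odim E)) (g : 'M[K]_(odim E, odim X)) :
  tors T -> Ulab T Y -> exact_seq f g -> T X ->
  ~ (exists s : 'M[K]_(odim X, odim E), ohom s /\ s *m g = 1%:M) -> T E.
Proof.
move=> tT UY s TX nsplit; apply: (lperp_rperp tT); apply/rperp_op.
apply: (@Dlab_extension K (op C) (rperp T) (rperp_tors_op T)
         _ _ _ _ _ (Ulab_op UY) (exact_op s)).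
  by apply/rperp_op; apply: gen_sub.
move=> [r [hr rf]]; apply: nsplit; apply: (retraction_section s hr).
by apply: trmx_inj; rewrite trmx_mul trmxK trmx1.
Qed.

End IsoFacts.

(** * The image of pop-down *)

Section PopDownNecessary.
Variables (K : fieldType) (C : lincat K) (S T : C -> Prop).
Hypotheses (fin : fin_tors C) (spl : splicing C).
Hypotheses (tS : tors S) (tT : tors T) (popT : eq_cl (popd S) T).
Implicit Types (L M N U X Y E : C).

Let T_S M : T M -> S M. Proof. by case: popT => _ s /s []. Qed.

Let T_lower M T1 : is_cover T1 S -> T M -> T1 M.
Proof. by case: popT => _ s cov /s [_]; apply. Qed.

(** Projectivity makes the objects without nonzero maps from [P] a torsion class. It contains the
    lower labels of [S], because [P] lies in every lower cover of [S]; hence it contains [S], and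
    [P] itself. *)
Lemma popd_no_projective P : proj_ob P -> T P -> odim P = 0%N.
Proof.
move=> pP TP; pose H M := forall h : 'M[K]_(odim P, odim M), ohom h -> h = 0.
have tH : tors H.
  split.
  - by move=> M M0 h _; apply: mx_dim0r.
  - move=> M N g HM hg gg h hh; have [l [hl lg]] := pP _ _ g h hg gg hh.
    by rewrite -lg (HM l hl) mul0mx.
  - move=> X' E X f g s HX' HX h hh; have [_ hg _ _ _] := s.
    have [h' hh' ->] := exact_factor_ker s hh (HX _ (hom_comp hh hg)).
    by rewrite (HX' h' hh') mul0mx.
have HP : H P.
  apply: (gen_min tH) (Dlab_gen tS fin (T_S TP)) => X [T1 [cov [_ _ FX]]] h hh.
  by apply: FX hh; apply: T_lower cov TP.
exact: id_dim0 (HP 1%:M (hom_id P)).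
Qed.

(** An object of [S] without nonzero maps to lower labels lies in every lower cover of [S], hence in
    [T]. *)
Lemma popd_hom_Dlab M : S M -> rperp T M -> (0 < odim M)%N ->
  exists X (h : 'M[K]_(odim M, odim X)), [/\ Dlab S X, ohom h & h <> 0].
Proof.
move=> SM FM M0; apply: NNPP => nex.
suff TM : T M by move: M0; rewrite (self_perp_dim0 TM FM).
case: popT => s _; apply: s; split=> // T1 cov; have [X lab] := label_exists cov.
apply: (cover_lperp_label cov lab SM) => h hh; apply: NNPP => h0.
by apply: nex; exists X, h; split=> //; exists T1.
Qed.

Lemma Dlab_popd_perp X : Dlab S X -> rperp T X.
Proof.
by move=> [T1 [cov [_ _ FX]]]; apply: rperp_anti FX => M; apply: T_lower.
Qed.

(** Induction on the dimension of [E]: a nonzero map from [E] to a lower label [X] of [S] is onto,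
    and its kernel [E1] is again in [S] and torsion-free. *)
Lemma wide_coker U E Q (f : 'M[K]_(odim U, odim E)) (g : 'M[K]_(odim E, odim Q)) :
  exact_seq f g -> S U -> rperp T U -> S E -> rperp T E -> rperp T Q.
Proof.
have [n] := ubnP (odim E); elim: n U E Q f g => // n IH U E Q f g; rewrite ltnS => leEn.
move=> s SU FU SE FE; have [hf hg /andP [ff gg] fg dE] := s.
have [E0|Epos] := posnP (odim E).
  move=> N u _ _; apply: mx_dim0r; apply/eqP; rewrite -leqn0 -[X in (_ <= X)%N]E0.
  by rewrite -dE leq_addl.
have [X [h [DX hh h0]]] := popd_hom_Dlab SE FE Epos.
have hfull := Dlab_epi DX hh SE h0.
have [E1 [k sk]] := epi_exact hh hfull; have [hk _ /andP [kk _] kh dk] := sk.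
have SE1 : S E1 := Dlab_ker DX sk SE.
have FE1 : rperp T E1 := rperp_sub hk kk FE.
have ltE1 : (odim E1 < n)%N.
  apply: leq_trans leEn; rewrite -dk -[X in (X < _)%N]addn0 ltn_add2l.
  exact: Dlab_dim DX.
have [fh0|fh0] := classic (f *m h = 0).
  have [f1 hf1 fE] := exact_factor_ker sk hf fh0.
  have ff1 : row_free f1 by apply: (@row_free_compl _ _ _ _ _ k); rewrite -fE.
  have [Q1 [g1 s1]] := mono_exact hf1 ff1; have FQ1 := IH _ _ _ _ _ ltE1 s1 SU FU SE1 FE1.
  have [_ hg1 /andP [_ gg1] fg1 d1] := s1.
  (* Here [U] lies in [E1], and [Q] is recognised by dimension as the pushout [P], an extension of
     [X] by the cokernel [Q1] of [U] in [E1]. *)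
  have [P [f' [g' [h' [[s' hh' e1 e2] [_ h'full _]]]]]] := pushout sk hg1.
  have FP : rperp T P := rperp_ext s' FQ1 (Dlab_popd_perp DX).
  have [_ _ _ _ dP] := s'.
  have [|w hw h'E] := exact_factor_coker s hh'.
    by rewrite fE -mulmxA e2 mulmxA fg1 mul0mx.
  apply: rperp_sub hw _ FP; apply: row_free_eq_dim.
    by apply: (@row_full_compr _ _ _ _ g); rewrite -h'E; apply: h'full.
  by apply/eqP; rewrite -(eqn_add2l (odim U)) dE -dP addnA d1 dk.
have fhfull := Dlab_epi DX (hom_comp hf hh) SU fh0.
(* Here [U] itself maps onto [X]. With [U1] the kernel, the cokernel [Q1] of [U1] in [E1] is
   isomorphic to [Q]. *)
have [U1 [l sl]] := epi_exact (hom_comp hf hh) fhfull.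
have [hl _ /andP [ll _] lfh dl] := sl.
have SU1 : S U1 := Dlab_ker DX sl SU.
have FU1 : rperp T U1 := rperp_sub hl ll FU.
have [|f1 hf1 lfE] := exact_factor_ker sk (hom_comp hl hf); first by rewrite -mulmxA.
have ff1 : row_free f1.
  by apply: (@row_free_compl _ _ _ _ _ k); rewrite -lfE; apply: row_free_comp.
have [Q1 [g1 s1]] := mono_exact hf1 ff1; have FQ1 := IH _ _ _ _ _ ltE1 s1 SU1 FU1 SE1 FE1.
have [_ hg1 /andP [_ gg1] fg1 d1] := s1.
have [|a ha kgE] := exact_factor_coker s1 (hom_comp hk hg).
  by rewrite mulmxA -lfE -mulmxA fg mulmx0.
have kgfull : row_full (k *m g).
  apply: coker_zero_full => [|D c hc kgc]; first exact: hom_comp.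
  have [|d hd gcE] := exact_factor_coker sk (hom_comp hg hc); first by rewrite mulmxA.
  have d0 : d = 0.
    apply: (row_full_inj fhfull).
    by rewrite /= mulmx0 -mulmxA -gcE mulmxA fg mul0mx.
  by apply: (row_full_inj gg); rewrite /= gcE d0 !mulmx0.
have afull : row_full a by apply: (@row_full_compr _ _ _ _ g1); rewrite -kgE.
have afree : row_free a.
  apply: row_free_eq_dim => //; apply/eqP.
  rewrite -(eqn_add2l (odim U1)) d1 -(eqn_add2r (odim X)) dk addnAC dl.
  by rewrite dE.
have [b [hb _ ba]] := iso_inv ha afree afull.
move=> N u TN hu; rewrite -[u]mulmx1 -ba mulmxA.
by rewrite (FQ1 _ (u *m b)) ?mul0mx //; apply: hom_comp.
Qed.

(** Suppose not, and take a subobject [V] of [X], torsion-free and in [S], with smallest quotient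
    [B]. No torsion-free object of [S] maps nontrivially to [B]: the preimage [R] of an image in [B]
    would either enlarge [V], or be all of [X] and give an epimorphism onto [X] by pullback. *)
Lemma wide_epi X : Dlab T X ->
  exists U (u : 'M[K]_(odim U, odim X)), [/\ S U, rperp T U, ohom u & row_full u].
Proof.
move=> DX; apply: NNPP => none; have TX := Dlab_in DX.
pose P B := exists V (i : 'M[K]_(odim V, odim X)) (q : 'M[K]_(odim X, odim B)),
  [/\ exact_seq i q, S V & rperp T V].
have [|B [V [i [q [s SV FV]]]] minB] := @exists_min_dim K C P.
  have [V [k sk]] := epi_exact (hom_id X) (row_full_id K (odim X)).
  have V0 : odim V = 0%N.
    by have [_ _ _ _ d] := sk; apply/eqP; rewrite -(eqn_add2r (odim X)) d.
  exists X, V, k, 1%:M; split=> //; first exact: tors_zero.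
  by move=> N u _ _; apply: mx_dim0r.
have [hi hq /andP [ii qq] iq dX] := s.
have homB U (u : 'M[K]_(odim U, odim B)) : S U -> rperp T U -> ohom u -> u = 0.
  move=> SU FU hu; have [I [e [m [he ee hm mm uE]]]] := image_factor hu.
  have SI : S I := tors_quot tS SU he ee.
  have [R [f' [g' [h' [[s' hh' e1 e2] [_ h'free _]]]]]] := pullback s hm.
  have SR : S R := tors_ext tS s' SV SI.
  have [h'full|nh'full] := classic (row_full h').
    have ufull : row_full u.
      rewrite uE; apply: row_full_comp ee _; apply: (@row_full_compr _ _ _ _ g').
      by rewrite -e2; apply: row_full_comp.
    have [R2 [f2 [g2 [h2 [[s2 hh2 _ _] [h2full _ _]]]]]] := pullback s hu.
    case: none; exists R2, h2; split=> //; last exact: h2full.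
      exact: tors_ext tS s2 SV SU.
    exact: rperp_ext s2 FV FU.
  have FR : rperp T R := Dlab_sub DX hh' (h'free mm) nh'full.
  have [B' [q' sB']] := mono_exact hh' (h'free mm).
  have leB : (odim B <= odim B')%N by apply: minB; exists R, h', q'.
  have I0 : odim I = 0%N.
    have [_ _ _ _ d1] := s'; have [_ _ _ _ d2] := sB'.
    have : (odim V + (odim I + odim B') = odim V + odim B)%N by rewrite addnA d1 d2 dX.
    move=> /addnI d3; move: leB; rewrite -d3 -[X in (_ <= X)%N]add0n leq_add2r leqn0.
    by move/eqP.
  by rewrite uE (mx_dim0l m I0) mulmx0.
have TB : T B := tors_quot tT TX hq qq.
(* This torsion class is proper in [S] because [B] is a nonzero object of [S]. The lower cover above
   it has a label without nonzero maps to [B], so the label would belong to the cover. *)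
pose C0 M := S M /\ lperp (fun N => N = B) M.
have [|||T1 cov sC0] := @lower_cover_above K C fin C0 S _ tS.
- exact: tors_cap tS (lperp_tors _).
- by move=> M [].
- move=> s0; have [_ Bp] := s0 _ (T_S TB).
  have B0 := id_dim0 (Bp B 1%:M erefl (hom_id B)).
  by apply: none; exists V, i; split=> //; apply: exact_right0_full s B0.
have [Y lab] := label_exists cov; apply: (label_notin lab); apply: sC0.
have [_ SY FY] := lab; split=> // N f NB hf; subst N; apply: homB => //.
by apply: Dlab_popd_perp; exists T1.
Qed.

(** Right exactness replaces [X'] by [U] from [wide_epi]. A nonsplit extension of [X] by [U] would
    be torsion-free and in [S], making its cokernel [X] torsion-free by [wide_coker]. *)
Lemma popd_ext_zero X X' : Dlab T X -> Dlab T X' -> ext_zero X X'.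
Proof.
move=> DX DX'; have [U [u [SU FU hu uu]]] := wide_epi DX'.
apply: (ext_zero_epi spl hu uu) => E f g s; apply: NNPP => nsplit.
have FE := Dlab_extension tT DX s FU nsplit; have TX := Dlab_in DX.
have FX := wide_coker s SU FU (tors_ext tS s SU (T_S TX)) FE.
by have := Dlab_dim DX; rewrite (self_perp_dim0 TX FX).
Qed.

End PopDownNecessary.

(** * Pop-up, upper labels, and the pop-down of a pop-up *)

Section PopUp.
Variables (K : fieldType) (C : lincat K) (T : C -> Prop).
Hypothesis tT : tors T.
Implicit Types (L M N U X Y E : C).

Lemma popu_tors : tors (popu T).
Proof.
split.
- by move=> M M0 T' tT' _ _; apply: tors_zero tT' M0.
- by move=> M N g SM hg gg T' tT' s1 s2; apply: tors_quot tT' (SM _ tT' s1 s2) hg gg.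
- move=> X' E X f g s SX' SX T' tT' s1 s2.
  exact: tors_ext tT' s (SX' _ tT' s1 s2) (SX _ tT' s1 s2).
Qed.

Lemma sub_popu : sub_cl T (popu T).
Proof. by move=> M TM T' _ s _; apply: s. Qed.

Lemma Ulab_popu Y : Ulab T Y -> popu T Y.
Proof. by move=> [T2 [cov [_ T2Y _]]] T' _ _ s; apply: s cov _ T2Y. Qed.

Lemma popu_min T' : tors T' -> sub_cl T T' -> sub_cl (Ulab T) T' -> sub_cl (popu T) T'.
Proof.
move=> tT' s1 s2 M SM; apply: SM => // T2 cov; have [Y lab] := label_exists cov.
move=> N /(cover_gen_label cov lab); apply: gen_min => // L [/s1 //|LY]; subst L.
by apply: s2; exists T2.
Qed.

(** Pop-up is generated by [T] and its upper labels, so a nonzero object of it receives a nonzero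
    map from one of these, and [T] is excluded by torsion-freeness. *)
Lemma wide_socle M : popu T M -> rperp T M -> (0 < odim M)%N ->
  exists Y (h : 'M[K]_(odim Y, odim M)), [/\ Ulab T Y, ohom h & h <> 0].
Proof.
move=> SM FM M0; apply: NNPP => nex.
have gM : gen (fun N => T N \/ Ulab T N) M.
  by apply: popu_min SM; [apply: gen_tors | |] => N HN; apply: gen_sub; [left | right].
suff : odim M = 0%N by move=> Mz; rewrite Mz in M0.
apply: (@id_dim0 K); apply: gM (hom_id M) => N f [TN|UN] hf; first exact: FM hf.
by apply: NNPP => f0; apply: nex; exists N, f.
Qed.

(** One step of the filtration by upper labels, with the dimension drop that the inductions need. *)
Lemma wide_exact M : popu T M -> rperp T M -> (0 < odim M)%N ->
  exists Y Q (f : 'M[K]_(odim Y, odim M)) (g : 'M[K]_(odim M, odim Q)),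
    [/\ Ulab T Y, exact_seq f g, popu T Q, rperp T Q & (odim Q < odim M)%N].
Proof.
move=> SM FM M0; have [Y [f [UY hf f0]]] := wide_socle SM FM M0.
have ff := Ulab_mono UY hf FM f0; have [Q [g s]] := mono_exact hf ff.
have [_ hg /andP [_ gg] _ d] := s; exists Y, Q, f, g; split=> //.
- exact: tors_quot popu_tors SM hg gg.
- exact: Ulab_coker UY s FM.
- by rewrite -d -[X in (X < _)%N]add0n ltn_add2r (Ulab_dim UY).
Qed.

Lemma wide_top M : popu T M -> rperp T M -> (0 < odim M)%N ->
  exists Y (h : 'M[K]_(odim M, odim Y)), [/\ Ulab T Y, ohom h & h <> 0].
Proof.
have [n] := ubnP (odim M); elim: n M => // n IH M; rewrite ltnS => leMn SM FM M0.
have [Y [Q [f [g [UY s SQ FQ ltQ]]]]] := wide_exact SM FM M0.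
have [hf hg /andP [ff gg] _ d] := s.
have [Q0|Q0] := posnP (odim Q).
  have [h [hh fh hf1]] := iso_inv hf ff (exact_right0_full s Q0).
  exists Y, h; split=> // h0; move: (Ulab_dim UY).
  by rewrite (@id_dim0 K (odim Y)) // -fh h0 mulmx0.
have [Y' [h [UY' hh h0]]] := IH Q (leq_trans ltQ leMn) SQ FQ Q0.
by exists Y', (g *m h); split=> //; [apply: hom_comp | apply: comp_epi_neq0].
Qed.

Lemma wide_sub_Ulab_full M Y (m : 'M[K]_(odim M, odim Y)) :
  Ulab T Y -> popu T M -> (0 < odim M)%N -> ohom m -> row_free m -> row_full m.
Proof.
move=> UY SM M0 hm mm; have FM := rperp_sub hm mm (Ulab_perp UY).
have [Y' [h [UY' hh h0]]] := wide_socle SM FM M0.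
apply: (@row_full_compr _ _ _ _ h).
by have [] := Ulab_hom_iso tT UY' UY (hom_comp hh hm) (comp_mono_neq0 mm h0).
Qed.

(** If the torsion-free quotient [B] of [M] is nonzero, it maps nontrivially to an upper label [Y].
    Take a lower cover [S1] of [popu T] containing the objects without maps to [Y]. As [B] is in
    [S1], so is [Y]; then [S1] contains [T] and all upper labels, hence [popu T], a
    contradiction. *)
Lemma popd_popu_sub : fin_tors C -> sub_cl (popd (popu T)) T.
Proof.
move=> fin M pM; have [A [B [f [g [s TA FB]]]]] := torsion_part M tT.
have [hf hg /andP [ff gg] _ d] := s.
apply: (tors_ext tT s TA); have [B0|B0] := posnP (odim B); first exact: tors_zero tT B0.
have [SB lowB] : popd (popu T) B := tors_quot (popd_tors popu_tors) pM hg gg.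
have [Y [h [UY hh h0]]] := wide_top SB FB B0.
pose C0 N := popu T N /\ lperp (fun L => L = Y) N.
have [|||S1 cov sC0] := @lower_cover_above K C fin C0 _ _ popu_tors.
- exact: tors_cap popu_tors (lperp_tors _).
- by move=> N [].
- move=> s0; have [_ Yp] := s0 _ (Ulab_popu UY); move: (Ulab_dim UY).
  by rewrite (id_dim0 (Yp Y 1%:M erefl (hom_id Y))).
have [tS1 _ sub1 nsub _] := cov; case: nsub.
have S1Y : S1 Y.
  have [I [e [m [he ee hm mm hE]]]] := image_factor hh.
  have S1I : S1 I := tors_quot tS1 (lowB _ cov) he ee.
  apply: (tors_quot tS1 S1I hm); apply: (wide_sub_Ulab_full UY (sub1 _ S1I)) => //.
  rewrite lt0n; apply/eqP => I0; apply: h0.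
  by rewrite hE (mx_dim0l m I0) mulmx0.
apply: popu_min => // [N TN|Y' UY'].
  apply: sC0; split; first exact: sub_popu.
  by move=> L u LY hu; subst L; apply: Ulab_perp UY _ _ TN hu.
have [hz|/nonzero_hom [k hk k0]] :=
  classic (forall k : 'M[K]_(odim Y', odim Y), ohom k -> k = 0).
  apply: sC0; split; first exact: Ulab_popu UY'.
  by move=> L u LY; subst L; apply: hz.
have [kfree kfull] := Ulab_hom_iso tT UY' UY hk k0.
have [k' [hk' kk' _]] := iso_inv hk kfree kfull; apply: (tors_quot tS1 S1Y hk').
by apply/row_fullP; exists k.
Qed.

End PopUp.

(** * Sufficiency of the two conditions *)

Section PopDownSufficient.
Variables (K : fieldType) (C : lincat K) (T : C -> Prop).
Hypotheses (fin : fin_tors C) (spl : splicing C) (tT : tors T).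
Hypothesis extD : forall X X', Dlab T X -> Dlab T X' -> ext_zero X X'.
Hypothesis nproj : ~ (exists P, (0 < odim P)%N /\ proj_ob P /\ T P).
Implicit Types (L M N U X Y E Z : C).

Lemma ext_zero_tors X : tors (fun M : C => ext_zero X M).
Proof.
split.
- move=> M M0 E f g s; have [_ hg /andP [_ gg] _ _] := s.
  by have [t [ht _ tg]] := iso_inv hg (exact_left0_free s M0) gg; exists t.
- by move=> M N g ext hg gg; apply: (ext_zero_epi spl hg gg).
- by move=> X' E X'' f g s; apply: (ext_zero_extension s).
Qed.

Lemma ext_zero_T X M : Dlab T X -> T M -> ext_zero X M.
Proof.
move=> DX TM; apply: (gen_min (ext_zero_tors X)) (Dlab_gen tT fin TM) => X' DX'.
exact: extD.
Qed.

(** A label [Y] of an upper cover of [T] inside [gen W] receives a nonzero map from [Z]. The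
    cokernel [Q] of this map, if nonzero, would be in [T]; but every map from a lower label to [Q]
    lifts to [Y] and so vanishes. Hence [Z] maps onto [Y], and induction applies to the kernel. *)
Lemma ext_zero_perp_popu Z :
  rperp T Z -> (forall X, Dlab T X -> ext_zero X Z) -> popu T Z.
Proof.
have [n] := ubnP (odim Z); elim: n Z => // n IH Z; rewrite ltnS => leZn FZ extZ.
have [Z0|Zpos] := posnP (odim Z); first exact: tors_zero (popu_tors T) Z0.
pose W N := T N \/ N = Z.
have [||T2 cov s2] := @upper_cover_below K C fin T (gen W) tT (gen_tors _).
- by move=> M TM; apply: gen_sub; left.
- move=> s; have TZ : T Z by apply: s; apply: gen_sub; right.
  by rewrite (self_perp_dim0 TZ FZ) in Zpos.
have [Y lab] := label_exists cov; have UY : Ulab T Y by exists T2.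
have [_ T2Y FY] := lab.
have [|g hg g0] := @nonzero_hom K C Z Y.
  move=> hz; have : odim Y = 0%N; last by move=> Y0; move: (Ulab_dim UY); rewrite Y0.
  apply: (@id_dim0 K); apply: (s2 _ T2Y) (hom_id Y) => N f [TN|NZ] hf; first exact: FY hf.
  by subst N; apply: hz.
have [I [e [m [he ee hm mm gE]]]] := image_factor hg.
have [Q [c sQ]] := mono_exact hm mm; have [_ hc /andP [_ cc] mc dQ] := sQ.
have Q0 : odim Q = 0%N.
  apply: NNPP => Q0; have TQ : T Q.
    apply: (Ulab_quot tT UY hc cc) => cfree; apply: g0; rewrite gE.
    by rewrite (_ : m = 0) ?mulmx0 //; apply: (row_free_inj cfree); rewrite /= mc mul0mx.
  apply: Q0; apply: (@id_dim0 K); apply: (Dlab_gen tT fin TQ) (hom_id Q) => X h DX hh.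
  have [l hl lE] := ext_zero_lift sQ hh (ext_zero_epi spl he ee (extZ _ DX)).
  by rewrite -lE (FY _ l (Dlab_in DX) hl) mul0mx.
have gfull : row_full g by rewrite gE; apply: row_full_comp ee (exact_right0_full sQ Q0).
have [L [k sk]] := epi_exact hg gfull; have [hk _ /andP [kk _] kg dZ] := sk.
apply: (tors_ext (popu_tors T) sk); last exact: Ulab_popu.
apply: IH; last 1 first.
(* The kernel inherits the vanishing of Ext: the obstruction is a map from [X] in [T] to the
   torsion-free [Y]. *)
- move=> X DX E a b sab; have [ha hb /andP [_ bb] ab _] := sab.
  have [l hl al] := ext_zero_extend sab hk (extZ _ DX).
  have [|d hd lgE] := exact_factor_coker sab (hom_comp hl hg).
    by rewrite mulmxA al kg.
  have lg0 : l *m g = 0 by rewrite lgE (FY _ d (Dlab_in DX) hd) mulmx0.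
  have [r hr lE] := exact_factor_ker sk hl lg0.
  apply: (retraction_section sab hr); apply: (row_free_inj kk).
  by rewrite /= -mulmxA -lE al mul1mx.
- apply: leq_trans leZn; rewrite -dZ -[X in (X < _)%N]addn0 ltn_add2l.
  exact: Ulab_dim UY.
- exact: rperp_sub hk kk FZ.
Qed.

(* An upper label Z of the torsion class Ext(X,-) = 0 plays the role of the
   Auslander-Reiten translate of X, and E that of the middle term of the
   almost split sequence ending in X. *)
Lemma wide_cover_Dlab X : Dlab T X ->
  exists E (g : 'M[K]_(odim E, odim X)), [/\ popu T E, rperp T E, ohom g & row_full g].
Proof.
move=> DX; pose S M := @ext_zero K C X M; have tS : tors S := ext_zero_tors X.
have TS : sub_cl T S by move=> M; apply: ext_zero_T.
(* As [X] is a nonzero object of [T], it is not projective, so [S] is not everything and has an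
   upper cover. *)
have [|||S2 cov _] := @upper_cover_below K C fin S (fun _ => True) tS.
- by split.
- by [].
- move=> all; apply: nproj; exists X; split; first exact: Dlab_dim DX.
  by split; [apply: ext_zero_proj => M; apply: all | apply: Dlab_in].
have [Z lab] := label_exists cov; have UZ : Ulab S Z by exists S2.
have FZ : rperp T Z := rperp_anti TS (Ulab_perp UZ).
have [E [f [g [s nsplit]]]] :
    exists E (f : 'M[K]_(odim Z, odim E)) (g : 'M[K]_(odim E, odim X)),
    exact_seq f g /\ ~ (exists t : 'M[K]_(odim X, odim E), ohom t /\ t *m g = 1%:M).
  apply: NNPP => nex; apply: (label_notin lab) => E f g s; apply: NNPP => nsplit.
  by apply: nex; exists E, f, g.
have [hf hg /andP [ff gg] fg dE] := s.
have FE : rperp T E := Dlab_extension tT DX s FZ nsplit.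
exists E, g; split=> //; apply: ext_zero_perp_popu => // X' DX'.
(* In the second case a nonsplit extension [G] of [X'] by [Z] lies in [S], so [a] extends to [E] and
   induces a map from [X] to [X']. It is nonzero since [s] does not split, hence an isomorphism, and
   [E] is itself in [S]. *)
have [extZ|nextZ] := classic (ext_zero X' Z).
  exact: ext_zero_extension s extZ (extD DX' DX).
have [G [a [b [sab nsab]]]] :
    exists G (a : 'M[K]_(odim Z, odim G)) (b : 'M[K]_(odim G, odim X')),
    exact_seq a b /\ ~ (exists t : 'M[K]_(odim X', odim G), ohom t /\ t *m b = 1%:M).
  apply: NNPP => nex; apply: nextZ => G a b sab; apply: NNPP => nsab.
  by apply: nex; exists G, a, b.
have [ha hb /andP [aa bb] ab dG] := sab.
have extG : ext_zero X G := Ulab_extension tS UZ sab (TS _ (Dlab_in DX')) nsab.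
have [l hl fl] := ext_zero_extend s ha extG.
have [|h hh lbE] := exact_factor_coker s (hom_comp hl hb); first by rewrite mulmxA fl.
have h0 : h <> 0.
  move=> h0; have [|r hr lE] := exact_factor_ker sab hl; first by rewrite lbE h0 mulmx0.
  apply: nsplit; apply: (retraction_section s hr); apply: (row_free_inj aa).
  by rewrite /= -mulmxA -lE fl mul1mx.
have [hfree hfull] := Dlab_hom_iso DX DX' hh h0.
apply: ext_zero_isor hh hfree hfull _.
exact: Ulab_extension tS UZ s (TS _ (Dlab_in DX)) nsplit.
Qed.

(** It suffices to place each lower label [X] of [T] in [S1]. Otherwise [X] maps onto the label [B]
    of the cover, so [B] is in [T]. Torsion-free objects of [popu T] have no nonzero maps to [B],
    yet one of them maps onto [X]. *)
Lemma popd_popu_super : sub_cl T (popd (popu T)).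
Proof.
move=> M TM; split=> [|S1 cov]; first exact: sub_popu.
have [B lab] := label_exists cov; have [tS1 _ sub1 _ _] := cov.
have B0 := label_dim lab.
apply: (gen_min tS1) (Dlab_gen tT fin TM) => X DX {M TM}.
have SX : popu T X := sub_popu (Dlab_in DX).
apply: (cover_lperp_label cov lab SX) => h hh; apply: NNPP => h0.
have hfull := label_epi cov lab hh SX h0.
have TB : T B := tors_quot tT (Dlab_in DX) hh hfull.
(* A nonzero [v] is onto with kernel in [popu T]. The kernel is zero or all of [Y]; if zero, the
   inverse of [v] would be a map from [T] to a torsion-free object. *)
have homY Y (v : 'M[K]_(odim Y, odim B)) : Ulab T Y -> ohom v -> v = 0.
  move=> UY hv; apply: NNPP => v0.
  have vfull := label_epi cov lab hv (Ulab_popu UY) v0.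
  have [G [k sk]] := epi_exact hv vfull; have [hk _ /andP [kk _] kv d] := sk.
  have SG : popu T G := label_ker cov lab sk (Ulab_popu UY).
  have [G0|G0] := posnP (odim G).
    have [w [hw vw wv]] := iso_inv hv (exact_left0_free sk G0) vfull.
    by apply: v0; rewrite -[v]mulmx1 -wv (Ulab_perp UY TB hw) mul0mx mulmx0.
  apply: v0; apply: (row_full_inj (wide_sub_Ulab_full tT UY SG G0 hk kk)).
  by rewrite /= kv mulmx0.
have homW E (u : 'M[K]_(odim E, odim B)) : popu T E -> rperp T E -> ohom u -> u = 0.
  have [n] := ubnP (odim E); elim: n E u => // n IH E u; rewrite ltnS => leEn SE FE hu.
  have [E0|E0] := posnP (odim E); first exact: mx_dim0l.
  have [Y [Q [f [g [UY s SQ FQ ltQ]]]]] := wide_exact SE FE E0.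
  have [hf _ _ _ _] := s.
  have [u' hu' ->] := exact_factor_coker s hu (homY _ _ UY (hom_comp hf hu)).
  by rewrite (IH Q u' (leq_trans ltQ leEn)) // mulmx0.
have [E [g [SE FE hg gg]]] := wide_cover_Dlab DX.
exact: comp_epi_neq0 gg h0 (homW _ _ SE FE (hom_comp hg hh)).
Qed.

End PopDownSufficient.

Lemma im_popdP (K : fieldType) (C : lincat K) (T : C -> Prop) :
  fin_tors C -> splicing C -> tors T ->
  im_popd T <->
    (forall X X', Dlab T X -> Dlab T X' -> ext_zero X X') /\
    ~ (exists P, (0 < odim P)%N /\ proj_ob P /\ T P).
Proof.
move=> fin spl tT; split=> [[S [tS popT]]|[ext nproj]].
  split=> [X X'|[P [P0 [pP TP]]]]; first exact: popd_ext_zero fin spl tS tT popT X X'.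
  by rewrite (popd_no_projective fin tS popT pP TP) in P0.
exists (popu T); split; first exact: popu_tors.
by split; [apply: popd_popu_sub | apply: popd_popu_super].
Qed.

(** * Transport along equality of classes *)

Section Congruence.
Variables (K : fieldType) (C : lincat K).
Implicit Types S T : C -> Prop.

Lemma cover_eq_cll S T T1 : eq_cl S T -> is_cover S T1 -> is_cover T T1.
Proof.
move=> eST [c1 c2 c3 c4 c5]; have [ST TS] := eST; split=> //.
- exact: tors_eq_cl eST c1.
- by move=> M /TS /c3.
- by move=> s; apply: c4 => M /s /TS.
- move=> U tU s1 s2; have [|[a b]|e] := c5 U tU _ s2; last by right.
    by move=> M /ST /s1.
  by left; split=> M; [move/a /ST | move/TS /b].
Qed.

Lemma cover_eq_clr S T T1 : eq_cl S T -> is_cover T1 S -> is_cover T1 T.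
Proof.
move=> eST [c1 c2 c3 c4 c5]; have [ST TS] := eST; split=> //.
- exact: tors_eq_cl eST c2.
- by move=> M /c3 /ST.
- by move=> s; apply: c4 => M /ST /s.
- move=> U tU s1 s2; have [|e|[a b]] := c5 U tU s1; [|by left|].
    by move=> M /s2 /TS.
  by right; split=> M; [move/a /ST | move/TS /b].
Qed.

Lemma popd_eq_cl S T : eq_cl S T -> sub_cl (popd S) (popd T).
Proof.
move=> eST M [SM lowM]; split=> [|T1 cov]; first exact: eST.1.
by apply: lowM; apply: cover_eq_clr cov; split; [apply: eST.2 | apply: eST.1].
Qed.

Lemma lperp_rperp_eq S : tors S -> eq_cl (lperp (rperp S)) S.
Proof. by move=> tS; split; [apply: lperp_rperp | apply: gen_sub]. Qed.

End Congruence.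

(** * Pop-up as pop-down in the opposite category *)

Section PopUpDual.
Variables (K : fieldType) (C : lincat K) (T : C -> Prop).
Hypothesis tT : tors T.

Lemma Dlab_op_rperp X : @Dlab K (op C) (rperp T) X <-> Ulab T X.
Proof.
split=> [[F1 [cov [br FX F1X]]]|]; last exact: Ulab_op.
exists (@lperp K C F1); split; first exact: cover_eq_cll (lperp_rperp_eq tT) (cover_unop cov).
by split; [exact: brick_unop | apply/rperp_op | ].
Qed.

Lemma ext_zero_op X X' : @ext_zero K (op C) X X' <-> @ext_zero K C X' X.
Proof.
split=> ext E f g s.
  have [t [ht tE]] := ext _ _ _ (exact_op s); apply: (retraction_section s ht).
  by apply: trmx_inj; rewrite trmx_mul trmxK trmx1.
have [t [ht tE]] := ext _ _ _ (exact_unop s).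
have [r [hr rE]] := section_retraction (exact_unop s) ht tE.
exists r^T; split; first by rewrite /= /op_hom trmxK.
by apply: trmx_inj; rewrite trmx_mul trmxK trmx1.
Qed.

Lemma proj_ob_op I : @proj_ob K (op C) I <-> @inj_ob K C I.
Proof.
split=> pI.
  move=> X E f h hf ff hh.
  have [|||l [hl lE]] := pI E X f^T h^T; rewrite /= /op_hom ?trmxK ?row_full_tr //.
  by exists l^T; split=> //; apply: trmx_inj; rewrite trmx_mul trmxK.
move=> E X g h hg gg hh; have [|l [hl lE]] := pI X E g^T h^T hg _ hh.
  by rewrite row_free_tr.
exists l^T; split; first by rewrite /= /op_hom trmxK.
by apply: trmx_inj; rewrite trmx_mul trmxK.
Qed.

Lemma popd_op (S : C -> Prop) : tors S ->
  eq_cl (@popd K (op C) (rperp S)) (@rperp K C (popu S)).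
Proof.
move=> tS; split=> M.
  move=> [FM lowM] N f SN hf.
  (* The objects without nonzero maps to [M] form one of the upper bounds whose intersection is
     [popu S]. *)
  pose T' := @lperp K C (fun L => L = M).
  have : T' N; last by move=> TN; apply: TN hf.
  apply: SN; first exact: lperp_tors.
    by move=> L SL L' u e hu; subst L'; apply: FM SL hu.
  move=> T2 cov L T2L L' u e hu; subst L'.
  exact: (lowM _ (cover_op cov)) T2L hu.
move=> FM; split; first by apply: rperp_anti FM; apply: sub_popu.
move=> F1 cov; have [tF1 _ _ _ _] := cov; apply: (rperp_lperp tF1).
apply: rperp_anti FM => N F1N T' tT' s1 s2; apply: (s2 (@lperp K C F1)) F1N.
exact: cover_eq_cll (lperp_rperp_eq tS) (cover_unop cov).
Qed.

Lemma im_popd_op : @im_popd K (op C) (rperp T) <-> im_popu T.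
Proof.
split=> [[F [tF [s1 s2]]]|[S [tS [s1 s2]]]].
  have tS := @lperp_tors K C F; exists (@lperp K C F); split=> //.
  have [d1 d2] := popd_op tS.
  have eF : @eq_cl K (op C) F (@rperp K C (@lperp K C F)).
    by split; [exact: (@sub_rperp_lperp K C F) | exact: (rperp_lperp tF)].
  split=> M HM.
    apply: (lperp_rperp tT) => N f FN; apply: (@gen_sub K C (popu (@lperp K C F))) => //.
    by apply: d1; apply: (popd_eq_cl eF); apply: s2.
  apply: (lperp_rperp (popu_tors (@lperp K C F))) => N f FN; apply: (gen_sub HM).
  by apply: s1; apply: (@popd_eq_cl _ (op C) _ F _ _ (d2 _ FN)); split; case: eF.
exists (@rperp K C S); split; first exact: rperp_tors_op.
have [d1 d2] := popd_op tS; split=> M HM.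
  by apply: rperp_anti (d1 _ HM).
by apply: d2; apply: rperp_anti HM.
Qed.

End PopUpDual.

Lemma im_popuP (K : fieldType) (C : lincat K) (T : C -> Prop) :
  fin_tors C -> splicing C -> tors T ->
  im_popu T <->
    (forall Y Y', Ulab T Y -> Ulab T Y' -> ext_zero Y Y') /\
    ~ (exists I, (0 < odim I)%N /\ inj_ob I /\ rperp T I).
Proof.
move=> fin spl tT; rewrite -im_popd_op //.
rewrite (im_popdP (fin_tors_op fin) (splicing_op spl) (rperp_tors_op T)).
split=> -[ext ninj]; split.
- move=> Y Y' UY UY'; apply/ext_zero_op; apply: ext; exact/(Dlab_op_rperp tT).
- by move=> [I [I0 [iI FI]]]; apply: ninj; exists I; split=> //; split=> //; apply/proj_ob_op.
- move=> Y Y' /(Dlab_op_rperp tT) UY /(Dlab_op_rperp tT) UY'; apply/ext_zero_op; exact: ext.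
- by move=> [I [I0 [iI FI]]]; apply: ninj; exists I; split=> //; split=> //; apply/proj_ob_op.
Qed.

(** * The category of modules *)

Section ModuleLincat.
Variables (K : fieldType) (A : falgType K).
Implicit Types M N L P : rmodule A.

Lemma is_hom_mono_factor L M N (f : 'M[K]_(mdim L, mdim M)) (g : 'M[K]_(mdim M, mdim N)) :
  is_hom (M := L) (N := N) (f *m g) -> is_hom g -> row_free g -> is_hom f.
Proof.
move=> hfg hg gg a; apply: (row_free_inj gg) => /=.
by rewrite -mulmxA hfg -!mulmxA hg.
Qed.

Lemma is_hom_epi_factor L M N (f : 'M[K]_(mdim L, mdim M)) (g : 'M[K]_(mdim M, mdim N)) :
  is_hom (M := L) (N := N) (f *m g) -> is_hom f -> row_full f -> is_hom g.
Proof.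
move=> hfg hf ff a; apply: (row_full_inj ff) => /=.
by rewrite !mulmxA -hfg mulmxA hf.
Qed.

(** The action is transported through the pseudo-inverse of [k]. As [N] is existentially bound, its
    inclusion is related to [k] through row spaces, which avoids a cast between dimensions. *)
Lemma submodule M r (k : 'M[K]_(r, mdim M)) :
  row_free k -> (forall a, (k *m mact M a <= k)%MS) ->
  exists (N : rmodule A) (k' : 'M[K]_(mdim N, mdim M)),
    [/\ is_hom k', row_free k', mdim N = r & (k' <= k)%MS].
Proof.
move=> kk stab; pose x a := k *m mact M a *m pinvmx k.
have xk a : x a *m k = k *m mact M a by apply: mulmxKpV.
have lin c a b : x (c *: a + b) = c *: x a + x b.
  apply: (row_free_inj kk) => /=.
  by rewrite xk mact_linear mulmxDl -scalemxAl !xk mulmxDr -scalemxAr.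
have mul a b : x (a * b) = x a *m x b.
  apply: (row_free_inj kk) => /=.
  by rewrite -mulmxA !xk mact_mul !mulmxA xk.
have one : x 1 = 1%:M.
  by apply: (row_free_inj kk); rewrite /= xk mact_one mul1mx mulmx1.
by exists (RModule lin mul one), k; split=> //= a; rewrite xk.
Qed.

Lemma quotient_module M r (c : 'M[K]_(mdim M, r)) :
  row_full c -> (forall a, ((mact M a *m c)^T <= c^T)%MS) ->
  exists (N : rmodule A) (c' : 'M[K]_(mdim M, mdim N)),
    [/\ is_hom c', row_full c', mdim N = r & (c'^T <= c^T)%MS].
Proof.
move=> cc stab; pose x a := ((mact M a *m c)^T *m pinvmx c^T)^T.
have cx a : c *m x a = mact M a *m c.
  by apply: trmx_inj; rewrite trmx_mul trmxK mulmxKpV.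
have lin k a b : x (k *: a + b) = k *: x a + x b.
  apply: (row_full_inj cc) => /=.
  by rewrite cx mact_linear mulmxDl -scalemxAl -!cx mulmxDr -scalemxAr.
have mul a b : x (a * b) = x a *m x b.
  apply: (row_full_inj cc) => /=.
  by rewrite mulmxA !cx mact_mul -!mulmxA cx.
have one : x 1 = 1%:M.
  by apply: (row_full_inj cc); rewrite /= cx mact_one mul1mx mulmx1.
by exists (RModule lin mul one), c; split=> //= a; rewrite cx.
Qed.

Lemma module_kernel M N (f : 'M[K]_(mdim M, mdim N)) : is_hom f ->
  exists (L : rmodule A) (k : 'M[K]_(mdim L, mdim M)),
    [/\ is_hom k, row_free k, k *m f = 0 & (mdim L + \rank f)%N = mdim M].
Proof.
move=> hf; have stab a : (row_base (kermx f) *m mact M a <= row_base (kermx f))%MS.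
  rewrite !eq_row_base; apply/sub_kermxP; rewrite -mulmxA hf mulmxA.
  suff -> : row_base (kermx f) *m f = 0 by rewrite mul0mx.
  by apply/sub_kermxP; rewrite eq_row_base.
have [L [k [hk kk dL le]]] := submodule (row_base_free _) stab.
exists L, k; split=> //; first by apply/sub_kermxP; rewrite -(eq_row_base (kermx f)).
by rewrite dL mxrank_ker subnK // rank_leq_row.
Qed.

Lemma module_cokernel M N (f : 'M[K]_(mdim M, mdim N)) : is_hom f ->
  exists (L : rmodule A) (c : 'M[K]_(mdim N, mdim L)),
    [/\ is_hom c, row_full c, f *m c = 0 & (mdim L + \rank f)%N = mdim N].
Proof.
move=> hf; pose k := row_base (kermx f^T).
have kf : f *m k^T = 0.
  apply: trmx_inj; rewrite trmx_mul trmxK trmx0; apply/sub_kermxP.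
  by rewrite eq_row_base.
have kfull : row_full k^T by rewrite row_full_tr row_base_free.
have stab a : ((mact N a *m k^T)^T <= k^T^T)%MS.
  rewrite trmxK eq_row_base; apply/sub_kermxP; apply: trmx_inj.
  by rewrite trmx_mul !trmxK mulmxA -hf -mulmxA kf mulmx0 trmx0.
have [L [c [hc cc dL le]]] := quotient_module kfull stab.
exists L, c; split=> //.
  apply: trmx_inj; rewrite trmx_mul trmx0; apply/sub_kermxP.
  by move: le; rewrite trmxK eq_row_base.
by rewrite dL mxrank_ker mxrank_tr subnK // rank_leq_col.
Qed.

Lemma module_biproduct M N :
  exists (S : rmodule A) (i1 : 'M[K]_(mdim M, mdim S)) (i2 : 'M[K]_(mdim N, mdim S))
      (p1 : 'M[K]_(mdim S, mdim M)) (p2 : 'M[K]_(mdim S, mdim N)),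
      [/\ is_hom i1, is_hom i2, is_hom p1 & is_hom p2] /\
      [/\ i1 *m p1 = 1%:M, i2 *m p2 = 1%:M, i1 *m p2 = 0, i2 *m p1 = 0 &
          p1 *m i1 + p2 *m i2 = 1%:M /\ (mdim M + mdim N)%N = mdim S].
Proof.
pose x a := block_mx (mact M a) 0 0 (mact N a).
have lin k a b : x (k *: a + b) = k *: x a + x b.
  by rewrite /x !mact_linear scale_block_mx add_block_mx !scaler0 !addr0.
have mul a b : x (a * b) = x a *m x b.
  by rewrite /x !mact_mul mulmx_block !mulmx0 !mul0mx !addr0 add0r.
have one : x 1 = 1%:M by rewrite /x !mact_one -scalar_mx_block.
exists (RModule lin mul one), (row_mx 1%:M 0), (row_mx 0 1%:M),
  (col_mx 1%:M 0), (col_mx 0 1%:M).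
split; split=> /=; rewrite ?mul_row_col ?mul1mx ?mulmx1 ?mul0mx ?mulmx0 ?addr0 ?add0r //.
- by move=> a /=; rewrite mul_row_block mul_mx_row !mul1mx !mul0mx mulmx1 !mulmx0 !addr0.
- by move=> a /=; rewrite mul_row_block mul_mx_row !mul1mx !mul0mx mulmx1 !mulmx0 !add0r.
- by move=> a /=; rewrite mul_block_col mul_col_mx !mulmx1 !mulmx0 !mul1mx !mul0mx !addr0.
- by move=> a /=; rewrite mul_block_col mul_col_mx !mulmx1 !mulmx0 !mul1mx !mul0mx !add0r.
split=> //; rewrite !mul_col_row !mul1mx !mulmx0 !mul0mx add_block_mx !addr0 !add0r.
by rewrite -scalar_mx_block.
Qed.

Program Definition mod_lincat : lincat K :=
  @LinCat K (rmodule A) (@mdim K A) (@is_hom K A) _ _ _ _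
    is_hom_mono_factor is_hom_epi_factor module_kernel module_cokernel module_biproduct.
Next Obligation. by move=> a; rewrite mul1mx mulmx1. Qed.
Next Obligation. by move=> a; rewrite mul0mx mulmx0. Qed.
Next Obligation. by move=> a; rewrite mulmxA H -mulmxA H0 mulmxA. Qed.
Next Obligation. by move=> a; rewrite mulmxBr H H0 mulmxBl. Qed.

Import VectorInternalTheory.

(** The algebra acting on itself by right multiplication, in coordinates. The map [h M v] sends [a]
    to the translate of [v] by [a]. *)
Lemma regular_module : exists R : rmodule A,
  [/\ projective_mod R &
      forall M (v : 'rV[K]_(mdim M)),
        exists2 f : 'M[K]_(mdim R, mdim M), is_hom f & (v <= f)%MS].
Proof.
pose d := dim A.
pose x (a : A) : 'M[K]_d := \matrix_i v2r (@r2v K A (delta_mx 0 i) * a).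
have xE w a : w *m x a = v2r (@r2v K A w * a).
  rewrite {2}[w]row_sum_delta linear_sum mulr_suml linear_sum mulmx_sum_row.
  by apply: eq_bigr => i _; rewrite rowK !linearZ /= -scalerAl linearZ.
have eq_by_rows n (f g : 'M[K]_(d, n)) : (forall w : 'rV_d, w *m f = w *m g) -> f = g.
  by move=> e; apply/row_matrixP => i; rewrite !rowE e.
have lin k a b : x (k *: a + b) = k *: x a + x b.
  apply: eq_by_rows => w; rewrite mulmxDr -scalemxAr !xE mulrDr -scalerAr.
  by rewrite linearD linearZ.
have mul a b : x (a * b) = x a *m x b.
  by apply: eq_by_rows => w; rewrite mulmxA !xE v2rK mulrA.
have one : x 1 = 1%:M.
  by apply: eq_by_rows => w; rewrite xE mulr1 r2vK mulmx1.
pose R := RModule lin mul one.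
pose h M (v : 'rV[K]_(mdim M)) : 'M[K]_(mdim R, mdim M) :=
  \matrix_i (v *m mact M (@r2v K A (delta_mx 0 i))).
have mact_sum M n (c : 'I_n -> K) (u : 'I_n -> A) :
    mact M (\sum_i c i *: u i) = \sum_i c i *: mact M (u i).
  elim: n c u => [|n IH] c u.
    rewrite !big_ord0; have := mact_linear M 1 0 0.
    by rewrite !scale1r addr0 => /(congr1 (fun z => z - mact M 0)); rewrite addrK subrr.
  by rewrite !big_ord_recl mact_linear IH.
have hE M (v : 'rV[K]_(mdim M)) (w : 'rV_d) : w *m h M v = v *m mact M (@r2v K A w).
  rewrite {2}[w]row_sum_delta linear_sum mulmx_sum_row.
  under [in RHS]eq_bigr do rewrite linearZ.
  rewrite mact_sum mulmx_sumr; apply: eq_bigr => i _.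
  by rewrite rowK -scalemxAr.
have hom_h M v : is_hom (M := R) (h M v).
  by move=> a; apply: eq_by_rows => w; rewrite !mulmxA xE !hE v2rK mact_mul mulmxA.
exists R; split.
  move=> E X g u hg gg hu; have [s sg] := row_fullP gg.
  (* A lift is determined by the image of [1], for which any linear preimage serves. *)
  pose v := (v2r (1 : A) *m u) *m s.
  have vg : v *m g = v2r (1 : A) *m u by rewrite /v -mulmxA sg mulmx1.
  exists (h E v); split=> //; apply: eq_by_rows => w.
  rewrite mulmxA hE -mulmxA hg mulmxA vg -mulmxA -hu mulmxA.
  by rewrite xE v2rK mul1r r2vK.
move=> M v; exists (h M v) => //; apply/submxP; exists (v2r (1 : A)).
by rewrite hE v2rK mact_one mulmx1.
Qed.

Lemma hereditary_mod_splicing : hereditary A -> splicing mod_lincat.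
Proof.
move=> her; have [R [pR genR]] := regular_module.
apply: hereditary_splicing => [|M P f]; last exact: her.
exact: (@proj_biproduct_epi K mod_lincat R pR genR).
Qed.

End ModuleLincat.

Theorem theorem5p10 (K : fieldType) (A : falgType K) :
  basic_alg A -> hereditary A -> tors_finite A ->
  forall T : subcat A, torsion_class T ->
  (in_image_pop_down T <->
     (forall X X', Dlabels T X -> Dlabels T X' -> Ext1_vanishes X X') /\
     ~ (exists P, (0 < mdim P)%N /\ projective_mod P /\ T P)) /\
  (in_image_pop_up T <->
     (forall Y Y', Ulabels T Y -> Ulabels T Y' -> Ext1_vanishes Y Y') /\
     ~ (exists I, (0 < mdim I)%N /\ injective_mod I /\ perp T I)).
Proof.
move=> _ her fin T tT; have spl := hereditary_mod_splicing her; split.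
  (* For [mod_lincat A] the abstract notions unfold to the module-theoretic ones, so conversion
     bridges the two statements. *)
  exact: (@im_popdP K (mod_lincat A) T fin spl tT).
exact: (@im_popuP K (mod_lincat A) T fin spl tT).
Qed.
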